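(* Let $n \ge 1$ and let $\mathcal{B} = \cup_{x \in \mathbb{R}^n}\mathcal{B}(x)$ be a centered translation invariant differentiation basis in $\mathbb{R}^n$. For $r > 0$ and $x \in \mathbb{R}^n$ let $\mathcal{B}_r(x) = \{R \in \mathcal{B}(x) : \operatorname{diam} R < r\}$ and set $\mathcal{B}_r = \cup_{x \in \mathbb{R}^n}\mathcal{B}_r(x)$. Then $\mathcal{B}$ is a density basis if and only if for every $0 < \alpha < 1$ there exists $r = r(\alpha) > 0$ such that $C_{\mathcal{B}_r}(\alpha) < \infty$.
   Context: For each $x \in \mathbb{R}^n$ let $\mathcal{B}(x)$ be a nonempty collection of bounded open sets in $\mathbb{R}^n$ that contain $x$. The collection $\mathcal{B} = \cup_{x \in \mathbb{R}^n}\mathcal{B}(x)$ (understood as the family $x \mapsto \mathcal{B}(x)$, i.e. remembering which sets are assigned to which point) is a differentiation basis if for every $x$ the collection $\mathcal{B}(x)$ contains sets of arbitrarily small diameter. A basis of this type is called centered; this imposes no further condition: ''centered'' only refers to each set being assigned to a distinguished point $x$ that it contains (not necessarily a geometric center). The basis is translation invariant if, for all $x \in \mathbb{R}^n$, $R \in \mathcal{B}(0)$ if and only if $x + R \in \mathcal{B}(x)$. The basis $\mathcal{B}$ is a density basis if for every measurable set $E \subset \mathbb{R}^n$ and for almost every $x \in \mathbb{R}^n$, the equality $\chi_E(x) = \lim_{j \to \infty} \frac{1}{|R_j|}\int_{R_j} \chi_E$ holds for every sequence $\{R_j\}$ of sets in $\mathcal{B}(x)$ whose diameters tend to $0$. Here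 $|\cdot|$ is Lebesgue measure and $\chi_E$ the indicator function of $E$. The maximal operator associated to $\mathcal{B}$ is $M_{\mathcal{B}}f(x) = \sup_{R \in \mathcal{B}(x)} \frac{1}{|R|}\int_R |f|$, and for $0 < \alpha < 1$ the Tauberian constant is $$C_{\mathcal{B}}(\alpha) = \sup_{E} \frac{1}{|E|}\left|\{x \in \mathbb{R}^n : M_{\mathcal{B}}\chi_E(x) > \alpha\}\right|,$$ the supremum being over measurable $E \subset \mathbb{R}^n$ with $0 < |E| < \infty$. $M_{\mathcal{B}_r}$ and $C_{\mathcal{B}_r}(\alpha)$ are defined in the same way with $\mathcal{B}_r(x)$ in place of $\mathcal{B}(x)$. *)

(* Defs.v *)
From HB Require Import structures.
From mathcomp Require Import all_boot all_order all_algebra.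
From mathcomp Require Import all_classical all_reals all_analysis.
Import Order.TTheory GRing.Theory Num.Theory.
Import numFieldNormedType.Exports.

Set Implicit Arguments.
Unset Strict Implicit.
Unset Printing Implicit Defensive.

Local Open Scope classical_set_scope.
Local Open Scope ring_scope.
Local Open Scope ereal_scope.

(* Dimensions n >= 1 are written n.+1 throughout: R^n.+1 is 'rV[R]_n.+1.
   Lebesgue measure is built as the outer measure given by countable covers by
   closed boxes; its Caratheodory measurable sets are the Lebesgue measurable
   sets, and mathcomp-analysis turns it into a (complete) measure on them. *)
Section lebesgue.
Context {R : realType} {n : nat}.
Implicit Types (a b : 'rV[R]_n.+1) (A : set 'rV[R]_n.+1).

Definition box a b : set 'rV[R]_n.+1 :=
  [set x | forall i, (a ord0 i <= x ord0 i <= b ord0 i)%R].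

Definition box_volume a b : R :=
  (\prod_(i < n.+1) (b ord0 i - a ord0 i))%R.

Definition box_cover A : set (nat -> 'rV[R]_n.+1 * 'rV[R]_n.+1) :=
  [set F : nat -> 'rV[R]_n.+1 * 'rV[R]_n.+1 |
    (forall k i, ((F k).1 ord0 i <= (F k).2 ord0 i)%R) /\
    A `<=` \bigcup_k box (F k).1 (F k).2].

Definition lebesgue_rV A : \bar R :=
  ereal_inf [set \sum_(k <oo) (box_volume (F k).1 (F k).2)%:E |
             F in box_cover A].

Let cost (p : 'rV[R]_n.+1 * 'rV[R]_n.+1) : \bar R :=
  (box_volume p.1 p.2)%:E.

Let cost_ge0 A F k : box_cover A F -> 0 <= cost (F k).
Proof.
move=> [F12 _]; rewrite lee_fin; apply: prodr_ge0 => i _.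
by rewrite subr_ge0.
Qed.

Let lebesgue_rV_ge0 A : 0 <= lebesgue_rV A.
Proof.
apply: le_ereal_inf_tmp => _ [F cF <-].
by apply: nneseries_ge0 => k _ _; exact: (cost_ge0 _ cF).
Qed.

Let lebesgue_rV0 : lebesgue_rV set0 = 0.
Proof.
apply/eqP; rewrite eq_le lebesgue_rV_ge0 andbT.
apply: ereal_inf_lbound; exists (fun=> (0, 0)%R); first by split.
rewrite eseries0// => k _ _.
by rewrite /box_volume big_ord_recl subrr mul0r.
Qed.

Let le_lebesgue_rV : {homo lebesgue_rV : A B / A `<=` B >-> A <= B}.
Proof.
move=> A B AB; apply/ereal_inf_le_tmp => _ [F [F12 BF] <-].
by exists F => //; split => //; exact: subset_trans BF.
Qed.

Let lebesgue_rV_sigma_subadditive : sigma_subadditive lebesgue_rV.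
Proof.
move=> A; have [[i ioo]|] := pselect (exists i, lebesgue_rV (A i) = +oo).
  rewrite (eseries_pinfty _ _ ioo) ?leey// => k _.
  by rewrite -ltNye (lt_le_trans _ (lebesgue_rV_ge0 _)).
rewrite -forallNE => Aoo.
suff add2e (e : {posnum R}) :
    lebesgue_rV (\bigcup_n A n) <= \sum_(i <oo) lebesgue_rV (A i) + e%:num%:E.
  by apply/lee_addgt0Pr => _/posnumP[].
rewrite (le_trans _ (epsilon_trick _ _ _))//.
pose P k F := box_cover (A k) F /\
  \sum_(j <oo) cost (F j) <= lebesgue_rV (A k) + (e%:num / (2 ^ k.+1)%:R)%:E.
have [G PG] : {G & forall k, P k (G k)}.
  apply: (@choice _ _ P) => k; rewrite /P.
  have fA : lebesgue_rV (A k) \is a fin_num.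
    by rewrite ge0_fin_numE// ltey; exact/eqP.
  have e0 : (0 < e%:num / (2 ^ k.+1)%:R)%R by [].
  have [_ [F cF <-] /ltW FA] := lb_ereal_inf_adherent e0 fA.
  by exists F.
have G_ge0 x : 0 <= (cost \o uncurry G) x.
  by case: x => k j; exact: (cost_ge0 _ (PG k).1).
apply: (@le_trans _ _ (\esum_(i in setT) (cost \o uncurry G) i)).
  apply: ereal_inf_lbound => /=.
  have /card_esym/ppcard_eqP[f] := card_nat2.
  exists (uncurry G \o f).
    split => [k i|]; first by rewrite /=; case: (f k) => p q; exact: (PG p).1.1.
    move=> t [i _] /(PG i).1.2[j _ Bt]; exists (f^-1%FUN (i, j)) => //=.
    by rewrite invK ?inE.
  rewrite -(esum_pred_image (cost \o uncurry G) _ xpredT) ?[fun=> _]set_true//.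
  by rewrite image_eq.
rewrite (_ : esum _ _ = \sum_(i <oo) \sum_(j <oo ) cost (G i j)); last first.
  pose J : nat -> set (nat * nat) := fun i => [set (i, j) | j in setT].
  rewrite (_ : setT = \bigcup_k J k); last first.
    by rewrite predeqE => -[a b]; split => // _; exists a => //; exists b.
  rewrite esum_bigcupT /=; last 2 first.
    - apply/trivIsetP => i j _ _ ij.
      rewrite predeqE => -[p q] /=; split => //= -[] [_] _ [<-{p} _].
      by move=> [q' _] [] /esym/eqP; rewrite (negbTE ij).
    - by move=> x; exact: (G_ge0 x).
  rewrite -(image_id [set: nat]) -fun_true esum_pred_image//; last first.
    by move=> k _; apply: esum_ge0 => x _; exact: (G_ge0 x).
  apply: eq_eseriesr => /= j _.
  rewrite -(esum_pred_image (cost \o uncurry G) (pair j) predT)//=; last 2 first.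
    - by move=> k _; exact: (G_ge0 (j, k)).
    - by move=> ? ? _ _; exact: (@can_inj _ _ _ snd).
  by congr esum; rewrite predeqE => -[a b]; split; move=> [i _ <-]; exists i.
apply: lee_nneseries => k _.
  by move=> _; apply: nneseries_ge0 => j _ _; exact: (G_ge0 (k, j)).
exact: (PG k).2.
Qed.

HB.instance Definition _ := isOuterMeasure.Build R 'rV[R]_n.+1 lebesgue_rV
  lebesgue_rV0 lebesgue_rV_ge0 le_lebesgue_rV lebesgue_rV_sigma_subadditive.

End lebesgue.

Arguments lebesgue_rV : clear implicits.
Arguments lebesgue_rV R n A : rename.

(* R^n.+1 with the sigma-algebra of its Lebesgue measurable sets. *)
Notation leb_rV R n := (caratheodory_type (lebesgue_rV R n)).

Definition lebesgue_measure_rV (R : realType) (n : nat) :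
  set (leb_rV R n) -> \bar R := lebesgue_rV R n.
Arguments lebesgue_measure_rV : clear implicits.

HB.instance Definition _ (R : realType) (n : nat) :=
  isMeasure.Build _ (leb_rV R n) R (lebesgue_measure_rV R n)
    (@caratheodory_measure0 _ _ (lebesgue_rV R n))
    (@caratheodory_measure_ge0 _ _ (lebesgue_rV R n))
    (@caratheodory_measure_sigma_additive _ _ (lebesgue_rV R n)).

Section differentiation_bases.
Context {R : realType} {n : nat}.
Local Notation T := (leb_rV R n).
Local Notation mu := (lebesgue_measure_rV R n).
Implicit Types (x : 'rV[R]_n.+1) (S E : set 'rV[R]_n.+1) (f : T -> R).

(* The library norm on 'rV[R]_n.+1 is the sup norm, so the Euclidean norm,
   used for diameters, is spelled out. *)
Definition enorm x : R := Num.sqrt (\sum_(i < n.+1) x ord0 i ^+ 2)%R.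

Definition diam S : \bar R :=
  ereal_sup [set (enorm (p.1 - p.2))%:E | p in S `*` S].

(* A family of sets x |-> B(x); [B x S] reads "S belongs to B(x)". *)
Definition basis_family := 'rV[R]_n.+1 -> set (set 'rV[R]_n.+1).

Implicit Types B : basis_family.

Definition differentiation_basis B :=
  forall x, [/\ B x !=set0,
    forall S, B x S -> [/\ bounded_set S, open S & S x] &
    forall e : R, (0 < e)%R -> exists2 S, B x S & diam S < e%:E].

Definition translation_invariant B :=
  forall x S, B 0%R S <-> B x [set (x + y)%R | y in S].

(* In the intended use S is a nonempty bounded open set, for which
   0 < mu S < +oo. *)
Definition average f S : \bar R :=
  (fine (mu S))^-1%:E * \int[mu]_(y in S) (f y)%:E.

Definition density_basis B :=
  forall E : set T, measurable E ->
    {ae mu, forall x, forall S_ : nat -> set 'rV[R]_n.+1,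
      (forall j, B x (S_ j)) ->
      diam (S_ j) @[j --> \oo] --> 0 ->
      average \1_E (S_ j) @[j --> \oo] --> (\1_E x : R)%:E}.

Definition maximal B f x : \bar R :=
  ereal_sup [set average (fun y => `|f y|%R) S | S in B x].

(* The superlevel set is measured by [mu] as an outer measure, so the
   definition makes sense for any B. *)
Definition tauberian B (alpha : R) : \bar R :=
  ereal_sup [set (fine (mu E))^-1%:E *
                 mu [set x | alpha%:E < maximal B \1_E x] |
    E in [set E : set T | measurable E /\ 0 < mu E < +oo]].

Definition small_basis B (r : R) : basis_family :=
  fun x => [set S | B x S /\ diam S < r%:E].

End differentiation_bases.

Arguments basis_family : clear implicits.

(* Main.v *)
Require Import Defs.
From mathcomp Require Import all_boot all_order all_algebra.
From mathcomp Require Import all_classical all_reals all_analysis.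
From mathcomp Require Import measurable_realfun.
From mathcomp Require Import ring lra zify.
Import Order.TTheory GRing.Theory Num.Theory.
Import numFieldNormedType.Exports.

Set Implicit Arguments.
Unset Strict Implicit.
Unset Printing Implicit Defensive.

Local Open Scope classical_set_scope.
Local Open Scope ring_scope.

(** The mechanism is to compare averages with measures of superlevel sets.
For a measurable set E, a level alpha and a radius r, call a point x heavy when
some S in B(x) of diameter < r satisfies |E `&` S| > alpha |S|; the heavy
points form the set {M_(B_r) chi_E > alpha}, and the Tauberian constant bounds
its measure by a multiple of |E|.

From Tauberian constants to density: let x lie outside E and be heavy for E at
level alpha for every r. Choose a closed F inside E with |E \ F| small. Small
sets around x avoid F, so x is heavy for E \ F, and the Tauberian bound makes
the set of such x smaller than a constant times |E \ F| ([exceptional_null]).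
Applied to E and to its complement along alpha = 1/(k+2), this gives the density
property off a countable union of null sets.

From density to Tauberian constants: suppose that the constant is infinite at
level alpha for every r. For each r some E has |heavy(E)| > c |E| with c as
large as desired. Heaviness is local, so a pigeonhole over unit cells
([heavy_localize]) and a translation, which is where translation invariance
enters, put the heavy points in the unit cell Q0 at the cost of a
dimensional constant. Translation invariance also makes the set O of heavy
points open ([open_heavy]). Averaging over the shifts of a fine grid shows that
some translate of O captures a proportion comparable to |O| of any prescribed
subset of Q0 ([exists_overlap]); about 1/|O| greedy steps cover half of Q0, and the same
translates of E have total measure about |E|/|O| < 1/c ([heavy_spread]). Doing
this for r = 1/(k+1) with summable measures gives a set U, smaller than a
quarter of Q0, such that half of Q0 is heavy for U at every radius. Points of
that half outside U contradict density ([density_heavy]).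

The preliminary part derives, for the outer measure given by covers with boxes,
positivity on open sets, translation invariance, measurability of open sets
and regularity. *)

(** * Volume and countable covers by boxes *)

(** For each value t of the first coordinate, the boxes whose first side contains t
cover the remaining coordinates, so induction on the dimension bounds the slice
volume; integrating in t over the first side, with one-dimensional Lebesgue
measure and monotone convergence, gives the claim. The predicate P records
which boxes survive in a slice. *)
Lemma volume_le_cover (R : realType) (d : nat) (a b : 'I_d -> R)
    (A B : nat -> 'I_d -> R) (P : pred nat) :
  (forall i, a i <= b i) -> (forall k i, A k i <= B k i) ->
  (forall x : 'I_d -> R, (forall i, a i <= x i <= b i) ->
    exists2 k, P k & forall i, A k i <= x i <= B k i) ->
  ((\prod_i (b i - a i))%:E <=
    \sum_(0 <= k <oo | P k) (\prod_i (B k i - A k i))%:E)%E.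
Proof.
elim: d a b A B P => [|d IH] a b A B P ab AB cov.
  have [|k Pk _] := cov (fun=> 0); first by case.
  rewrite big_ord0 (nneseriesD1 (n := k))//; last first.
    by move=> j _; rewrite lee_fin big_ord0.
  rewrite big_ord0 leeDl// nneseries_ge0// => j _ _.
  by rewrite lee_fin big_ord0.
pose vol k := \prod_i (B k (lift ord0 i) - A k (lift ord0 i)).
have vol_ge0 k : 0 <= vol k by apply: prodr_ge0 => i _; rewrite subr_ge0.
pose D : set (measurableTypeR R) := `[a ord0, b ord0]%classic.
pose I k : set (measurableTypeR R) := `[A k ord0, B k ord0]%classic.
pose f k (t : measurableTypeR R) : \bar R := if P k then (vol k * \1_(I k) t)%:E else 0%E.
have mD : measurable D by exact: measurable_itv.
have mI k : measurable (I k) by exact: measurable_itv.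
have f_ge0 k t : (0 <= f k t)%E.
  by rewrite /f; case: ifP => // _; rewrite lee_fin mulr_ge0.
have mE (g : measurableTypeR R -> R) :
    measurable_fun D g -> measurable_fun D (fun t => (g t)%:E).
  by move=> mg; exact: ((@measurable_EFinP _ _ R D g).2 mg).
have mf k : measurable_fun D (f k).
  rewrite /f; case: (P k) => //; apply: mE.
  by apply: measurable_funM => //; exact: measurable_indic.
have slice t : D t ->
    ((\prod_i (b (lift ord0 i) - a (lift ord0 i)))%:E <=
      \sum_(0 <= k <oo) f k t)%E.
  rewrite /D /= in_itv /= => Dt.
  pose Pt k := P k && (t \in I k).
  have := IH (a \o lift ord0) (b \o lift ord0) (fun k => A k \o lift ord0)
    (fun k => B k \o lift ord0) Pt.
  rewrite /=; move/(_ (fun i => ab _) (fun k i => AB k _)) => H.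
  apply: (le_trans (H _)).
    move=> x xab.
    pose y i := if unlift ord0 i is Some j then x j else t.
    have [i|k Pk yk] := cov y.
      by rewrite /y; case: unliftP => [j ->|->].
    exists k.
      rewrite /Pt Pk /= inE /I /= in_itv /=.
      by have := yk ord0; rewrite /y unlift_none.
    by move=> i; have := yk (lift ord0 i); rewrite /y liftK.
  rewrite eseries_mkcond; apply: lee_nneseries => k _.
    by move=> _; case: ifP => // _; rewrite lee_fin; exact: vol_ge0.
  rewrite /Pt /f; case: (P k); rewrite //= indicE.
  by case: (_ \in _); rewrite ?mulr1 ?mulr0.
rewrite big_ord_recl mulrC EFinM.
have lebD : lebesgue_measure D = (b ord0 - a ord0)%:E.
  rewrite /D lebesgue_measure_itv/= lte_fin; case: ltP => [|] h; rewrite -?EFinB//.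
  by congr _%:E; apply/eqP; have := ab ord0; lra.
rewrite -lebD -integral_cst//.
have cst_le : (\int[lebesgue_measure]_(t in D)
      (\prod_i (b (lift ord0 i) - a (lift ord0 i)))%:E <=
    \int[lebesgue_measure]_(t in D) \sum_(0 <= k <oo) f k t)%E.
  apply: ge0_le_integral => //.
  - by move=> t _; rewrite lee_fin; apply: prodr_ge0 => i _; rewrite subr_ge0.
  - exact: ge0_emeasurable_sum.
apply: (le_trans cst_le).
rewrite integral_nneseries// [leRHS]eseries_mkcond.
apply: lee_nneseries => k _; first by move=> _; apply: integral_ge0.
rewrite /f; case: (P k); last by rewrite integral0.
under eq_integral do rewrite EFinM.
rewrite ge0_integralZl//; last 2 first.
- by apply: mE; exact: measurable_indic.
- by rewrite lee_fin.
rewrite integral_indic// big_ord_recl mulrC EFinM lee_wpmul2l ?lee_fin//.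
apply: (@le_trans _ _ (lebesgue_measure (I k))).
  by apply: le_measure; rewrite ?inE//; exact: measurableI.
rewrite /I lebesgue_measure_itv/= lte_fin; case: ltP => [|] h; rewrite -?EFinB//.
by rewrite lee_fin subr_ge0.
Qed.

(** * Elementary properties of the Lebesgue outer measure *)

Section lebesgue_rV_theory.
Context {R : realType} {n : nat}.
Local Notation T := (leb_rV R n).
Local Notation mu := (lebesgue_measure_rV R n).
Implicit Types (x y v a b : 'rV[R]_n.+1) (A E S U : set 'rV[R]_n.+1).

Lemma open_rVP U : open U <-> forall x, U x -> exists2 e : R, 0 < e &
  forall y, (forall i, `|x ord0 i - y ord0 i| < e) -> U y.
Proof.
split=> [oU x Ux|hU].
  have /nbhs_ballP[e /= e0 xe] : nbhs x U by exact: open_nbhs_nbhs.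
  exists e => // y xy; apply: xe; split => // i j.
  by rewrite (ord1 i) /ball/=; exact: xy.
rewrite openE => x Ux; have [e e0 xe] := hU _ Ux.
apply/nbhs_ballP; exists e => //= y [_ xy]; apply: xe => i.
by have := xy ord0 i; rewrite /ball.
Qed.

Lemma leb_le A E : A `<=` E -> (mu A <= mu E)%E.
Proof. exact: (le_outer_measure (lebesgue_rV R n)). Qed.

Lemma leb_ge0 A : (0 <= mu A)%E.
Proof. exact: (outer_measure_ge0 (lebesgue_rV R n)). Qed.

Lemma leb_setU A E : (mu (A `|` E) <= mu A + mu E)%E.
Proof. exact: (outer_measureU2 (lebesgue_rV R n)). Qed.

Lemma leb_bigcup (F : nat -> set 'rV[R]_n.+1) :
  (mu (\bigcup_k F k) <= \sum_(0 <= k <oo) mu (F k))%E.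
Proof. exact: (outer_measure_sigma_subadditive (lebesgue_rV R n)). Qed.

Lemma leb_bigcup_seq (I : choiceType) (s : seq I) (F : I -> set 'rV[R]_n.+1) A :
  (forall x, A x -> exists2 i, i \in s & F i x) ->
  (mu A <= \sum_(i <- s) mu (F i))%E.
Proof.
elim: s A => [|i s IH] A cov.
  rewrite (_ : A = set0) ?measure0 ?big_nil//.
  by rewrite -subset0 => x /cov[].
rewrite big_cons; apply: (@le_trans _ _ (mu (F i `|` (A `\` F i)))).
  by apply: leb_le => x Ax; have [|] := pselect (F i x); [left|right].
apply: (le_trans (leb_setU _ _)); rewrite leeD2l//; apply: IH => x [Ax nFx].
have [j] := cov _ Ax; rewrite inE => /orP[/eqP->//|js Fjx].
by exists j.
Qed.

Lemma leb_box_le a b : (forall i, a ord0 i <= b ord0 i) ->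
  (mu (box a b) <= (box_volume a b)%:E)%E.
Proof.
move=> ab; apply: ereal_inf_lbound.
exists (fun k => if k == 0%N then (a, b) else (0, 0)).
  split=> [[|k] i//|x abx]; by exists 0%N.
rewrite (nneseriesD1 (n := 0%N))//=; last first.
  move=> [|k] _ /=; rewrite lee_fin; apply: prodr_ge0 => i _;
    by rewrite ?subr_ge0// subr0.
rewrite eseries0 ?adde0// => -[|k]//= _ _.
by rewrite /box_volume big_ord_recl subrr mul0r.
Qed.

Lemma leb_box_ge a b : (forall i, a ord0 i <= b ord0 i) ->
  ((box_volume a b)%:E <= mu (box a b))%E.
Proof.
move=> ab; apply: le_ereal_inf_tmp => _ [F [F12 cov] <-].
apply: volume_le_cover => // x xab.
have /cov[k _ Fkx] : box a b (\row_i x i) by move=> i; rewrite mxE.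
by exists k => // i; have := Fkx i; rewrite mxE.
Qed.

Definition translate v A : set 'rV[R]_n.+1 := [set (v + y)%R | y in A].

Lemma translateE v A x : translate v A x = A (x - v).
Proof.
apply/propext; split=> [[y Ay <-]|Axv]; first by rewrite addrC addKr.
by exists (x - v) => //; rewrite addrC subrK.
Qed.

Lemma translateK v A : translate (- v) (translate v A) = A.
Proof. by apply/seteqP; split=> x; rewrite !translateE opprK addrK. Qed.

Lemma leb_translate v A : mu (translate v A) = mu A.
Proof.
suff le w E : (mu (translate w E) <= mu E)%E.
  by apply/eqP; rewrite eq_le le/= -{1}(translateK v A) le.
apply: le_ereal_inf_tmp => _ [F [F12 cov] <-].
apply: ereal_inf_lbound; exists (fun k => (w + (F k).1, w + (F k).2)).
  split=> [k i|x]; first by rewrite !mxE lerD2l.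
  rewrite translateE => /cov[k _ Fkx]; exists k => // i.
  by have := Fkx i; rewrite !mxE; lra.
apply: eq_eseriesr => k _; congr _%:E; apply: eq_bigr => i _.
by rewrite !mxE; lra.
Qed.

Lemma measurable_translate v (A : set T) : measurable A -> measurable (translate v A : set T).
Proof.
move=> mA; suff : (lebesgue_rV R n).-caratheodory (translate v A) by [].
move=> X; have h (Y : set 'rV[R]_n.+1) : lebesgue_rV R n Y = lebesgue_rV R n (translate (- v) Y).
  by symmetry; exact: leb_translate.
have {}mA : (lebesgue_rV R n).-caratheodory A by [].
rewrite (h X) (h (X `&` translate v A)) (h (X `&` ~` translate v A)) [LHS]mA.
by congr (mu _ + mu _)%E; apply/funext => x;
  rewrite [RHS]translateE /setI /setC /mkset !translateE opprK addrK.
Qed.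

(** The volume is affine in each endpoint, hence additive under cutting the i-th
side at any m. *)
Lemma box_volume_cut a b i (m : R) :
  box_volume a b =
    box_volume a (\row_j if j == i then m else b ord0 j) +
    box_volume (\row_j if j == i then m else a ord0 j) b.
Proof.
rewrite /box_volume (bigD1 i)// [X in _ = X + _](bigD1 i)//.
rewrite [X in _ = _ + X](bigD1 i)//= !mxE eqxx.
rewrite [X in _ = _ * X + _](eq_bigr (fun j => b ord0 j - a ord0 j)); last first.
  by move=> j /negPf ji; rewrite mxE ji.
rewrite [X in _ = _ + _ * X](eq_bigr (fun j => b ord0 j - a ord0 j)); last first.
  by move=> j /negPf ji; rewrite mxE ji.
by rewrite -mulrDl [X in _ = X * _]addrC addrA subrK.
Qed.

(** Each box of a cover is cut at t, clamped to its i-th side, so that the two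
pieces cover the two parts of X and the total volume is unchanged. Leaving the
boundary of H free treats open and closed half-spaces at once. *)
Lemma measurable_halfspace i (t : R) (H : set T) :
  (forall x, x ord0 i < t -> H x) -> (forall x, H x -> x ord0 i <= t) ->
  measurable H.
Proof.
move=> ltH leH; apply: (@le_caratheodory_measurable _ _ (lebesgue_rV R n)) => X.
apply: le_ereal_inf_tmp => _ [F [F12 cov] <-].
(* If t lies outside the i-th side, one of the two pieces is degenerate. *)
pose m k := Num.max ((F k).1 ord0 i) (Num.min ((F k).2 ord0 i) t).
pose lo k := \row_j if j == i then m k else (F k).1 ord0 j.
pose hi k := \row_j if j == i then m k else (F k).2 ord0 j.
have lem k : (F k).1 ord0 i <= m k by rewrite le_max lexx.
have mle k : m k <= (F k).2 ord0 i.
  by rewrite ge_max F12 ge_min lexx.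
have Flo k j : lo k ord0 j <= (F k).2 ord0 j.
  by rewrite mxE; case: eqP => // ->.
have Fhi k j : (F k).1 ord0 j <= hi k ord0 j.
  by rewrite mxE; case: eqP => // ->.
have vol0 a b : (forall j, a ord0 j <= b ord0 j) -> (0 <= (box_volume a b)%:E)%E.
  by move=> ab; rewrite lee_fin; apply: prodr_ge0 => j _; rewrite subr_ge0.
rewrite (eq_eseriesr (fun k _ => congr1 EFin (box_volume_cut _ _ i (m k)))).
under eq_eseriesr do rewrite EFinD.
rewrite nneseriesD; last 2 first.
- by move=> k _ _; apply: vol0 => j; exact: Fhi.
- by move=> k _ _; apply: vol0 => j; exact: Flo.
apply: leeD; apply: ereal_inf_lbound.
  exists (fun k => ((F k).1, hi k)) => //; split=> [k j|x [/cov[k _ Fkx] Hx]].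
    exact: Fhi.
  exists k => // j /=; rewrite mxE; case: eqP => [->|_]; last exact: Fkx.
  by have := Fkx i; rewrite le_max le_min (leH _ Hx) andbT => /andP[-> ->]; rewrite orbT.
exists (fun k => (lo k, (F k).2)) => //; split=> [k j|x [/cov[k _ Fkx] Hx]].
  exact: Flo.
exists k => // j /=; rewrite mxE; case: eqP => [->|_]; last exact: Fkx.
have := Fkx i; rewrite ge_max ge_min => /andP[-> ->]/=; rewrite andbT orbC.
by rewrite leNgt; case: (boolP (_ < t)) => // /ltH.
Qed.

End lebesgue_rV_theory.

(** * Grid cells and open sets *)

Section cells.
Context {R : realType} {n : nat}.
Local Notation T := (leb_rV R n).
Local Notation mu := (lebesgue_measure_rV R n).
Implicit Types (x y v a b : 'rV[R]_n.+1) (A E S U : set 'rV[R]_n.+1).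
Implicit Types (N : nat) (z w : 'rV[int]_n.+1).

Definition cell_index N x : 'rV[int]_n.+1 :=
  \row_i Num.floor (N.+1%:R * x ord0 i).

(** The half-open cube of side 1/(N+1) with lower corner z/(N+1). Defining it as a
fibre of [cell_index] makes disjointness and covering immediate. *)
Definition cell N z : set 'rV[R]_n.+1 := [set x | cell_index N x = z].

Definition grid_point N z : 'rV[R]_n.+1 :=
  \row_i ((z ord0 i)%:~R / N.+1%:R).

Lemma cell_coord N z x : cell N z x <->
  forall i, (z ord0 i)%:~R / N.+1%:R <= x ord0 i < (z ord0 i + 1)%:~R / N.+1%:R.
Proof.
have N0 : (0 : R) < N.+1%:R by rewrite ltr0n.
split=> [<- i|xz]; last first.
  apply/rowP => i; rewrite !mxE; apply/eqP; rewrite floor_eq.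
  by have := xz i; rewrite ler_pdivrMr// ltr_pdivlMr// ![x ord0 i * _]mulrC.
rewrite mxE ler_pdivrMr// ltr_pdivlMr// ![x ord0 i * _]mulrC.
exact: floor_itv.
Qed.

Lemma cell_diff N z x y i : cell N z x -> cell N z y ->
  `|x ord0 i - y ord0 i| < N.+1%:R^-1.
Proof.
move=> /cell_coord/(_ i)/andP[zx xz] /cell_coord/(_ i)/andP[zy yz].
move: zx xz zy yz; rewrite intrD mulrDl [1%:~R / _]mul1r.
move: ((z ord0 i)%:~R / N.+1%:R : R) (N.+1%:R^-1 : R) => c e zx xz zy yz.
by rewrite ltr_norml; apply/andP; split; lra.
Qed.

Lemma translate_cell N z w : translate (grid_point N w) (cell N z) = cell N (w + z).
Proof.
apply/funext => x; rewrite translateE; apply/propext; rewrite !cell_coord.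
split=> h i; have := h i; rewrite !mxE !intrD !mulrDl.
  by rewrite lerBrDl ltrBlDl !addrA.
by rewrite lerBrDl ltrBlDl !addrA.
Qed.

Lemma measurable_cell N z : measurable (cell N z : set T).
Proof.
rewrite (_ : cell N z = \bigcap_(i in [set: 'I_n.+1])
  ([set x | x ord0 i < (z ord0 i + 1)%:~R / N.+1%:R] `&`
   ~` [set x | x ord0 i < (z ord0 i)%:~R / N.+1%:R])); last first.
  apply/seteqP; split=> [x /cell_coord xz i _|x xz].
    by have /andP[h1 h2] := xz i; split => //=; apply/negP; rewrite -leNgt.
  by apply/cell_coord => i; have [/= -> /negP] := xz i I; rewrite -leNgt => ->.
apply: fin_bigcap_measurable; first exact: finite_finset.
move=> i _; apply: measurableI; last apply: measurableC.
  by apply: (@measurable_halfspace R n i ((z ord0 i + 1)%:~R / N.+1%:R)) => x //=;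
    exact: ltW.
by apply: (@measurable_halfspace R n i ((z ord0 i)%:~R / N.+1%:R)) => x //=;
  exact: ltW.
Qed.

Lemma leb_cell_le N z : (mu (cell N z) <= ((N.+1%:R^-1) ^+ n.+1)%:E)%E.
Proof.
apply: (@le_trans _ _ (mu (box (grid_point N z) (grid_point N (z + const_mx 1))))).
  apply: leb_le => x /cell_coord xz i; have := xz i; rewrite !mxE.
  by move=> /andP[-> /ltW ->].
apply: (le_trans (leb_box_le _)).
  by move=> i; rewrite !mxE ler_pM2r ?invr_gt0 ?ltr0n// ler_int lerDl.
rewrite lee_fin /box_volume (eq_bigr (fun=> N.+1%:R^-1)); last first.
  by move=> i _; rewrite !mxE intrD mulrDl mul1r addrAC subrr add0r.
by rewrite prodr_const card_ord.
Qed.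

Lemma exists_invS_lt (e : R) : 0 < e -> exists N : nat, N.+1%:R^-1 < e.
Proof.
move=> e0; have [N _ h] := near_infty_natSinv_lt (PosNum e0).
by exists N; apply: (h N) => /=.
Qed.

(** An open set is the union of the countably many grid cells it contains. *)
Lemma measurable_open U : open U -> measurable (U : set T).
Proof.
move=> /open_rVP oU.
rewrite (_ : U = \bigcup_N \bigcup_(z in [set: 'rV[int]_n.+1])
    [set x | cell N z x /\ cell N z `<=` U]); last first.
  apply/seteqP; split=> [x Ux|x [N _ [z _ [zx]]]]; last exact.
  have [e e0 xe] := oU _ Ux; have [N Ne] := exists_invS_lt e0.
  exists N => //; exists (cell_index N x) => //; split => // y xy.
  by apply: xe => i; apply: lt_trans Ne; apply: (@cell_diff N (cell_index N x)).
apply: bigcupT_measurable => N; apply: countable_bigcupT_measurable => [|z].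
  exact: countableP.
have [zU|zU] := pselect (cell N z `<=` U).
  rewrite (_ : [set _ | _] = cell N z); first exact: measurable_cell.
  by apply/seteqP; split => x // -[].
rewrite (_ : [set _ | _] = set0)//; apply/seteqP; split => x // -[]//.
Qed.

Lemma leb_open_gt0 U : open U -> U !=set0 -> (0 < mu U)%E.
Proof.
move=> /open_rVP oU [x /oU[e e0 xe]].
pose a := x - const_mx (e / 2); pose b := x + const_mx (e / 2).
have ab i : b ord0 i - a ord0 i = e by rewrite !mxE; lra.
apply: (@lt_le_trans _ _ (mu (box a b))).
  apply: (lt_le_trans _ (leb_box_ge _)).
    by rewrite lte_fin; apply: prodr_gt0 => i _; rewrite ab.
  by move=> i; have := ab i; lra.
apply: leb_le => y aby; apply: xe => i.
by have := aby i; rewrite !mxE ltr_norml => /andP[h1 h2]; apply/andP; split; lra.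
Qed.

Lemma bounded_rVP S : bounded_set S ->
  exists2 M : R, 0 < M & forall x, S x -> forall i, `|x ord0 i| <= M.
Proof.
case=> M [_ SM]; exists (Num.max M 0 + 1) => [|x Sx i].
  by rewrite ltr_wpDl// le_max lexx orbT.
have h : M < Num.max M 0 + 1 by rewrite ltr_pwDr// le_max lexx.
apply: le_trans (SM _ h x Sx).
rewrite /Num.norm/= mx_normrE.
exact: (le_bigmax_cond _ (fun ij : 'I_1 * 'I_n.+1 => `|x ij.1 ij.2|) (j := (ord0, i))).
Qed.

Lemma leb_bounded S : bounded_set S -> (mu S < +oo)%E.
Proof.
move=> /bounded_rVP[M M0 SM].
apply: (@le_lt_trans _ _ (mu (box (const_mx (- M)) (const_mx M)))).
  by apply: leb_le => x Sx i; rewrite !mxE; have := SM _ Sx i; rewrite ler_norml.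
apply: (le_lt_trans (leb_box_le _)); last exact: ltry.
by move=> i; rewrite !mxE; lra.
Qed.

End cells.

(** * Approximation by open and closed sets *)

Section regularity.
Context {R : realType} {n : nat}.
Local Notation T := (leb_rV R n).
Local Notation mu := (lebesgue_measure_rV R n).
Implicit Types (x y v a b : 'rV[R]_n.+1) (A E S U X : set 'rV[R]_n.+1).

Lemma box_volume_expand a b (e : R) : 0 < e ->
  exists2 d : R, 0 < d &
    box_volume (a - const_mx d) (b + const_mx d) <= box_volume a b + e.
Proof.
move=> e0.
pose p (d : R) : R := \prod_(i < n.+1) (b ord0 i + d - (a ord0 i - d)).
have cp : continuous p.
  apply: continuous_big => [|i _ d]; first exact: mul_continuous.
  apply: cvgB; first by apply: cvgD; [exact: cvg_cst|exact: cvg_id].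
  by apply: cvgB; [exact: cvg_cst|exact: cvg_id].
have p0 : p 0 = box_volume a b.
  by apply: eq_bigr => i _; rewrite addr0 subr0.
have /cvgrPdist_le/(_ _ e0)/nbhs_ballP[d /= d0 hd] := cp 0.
exists (d / 2); first by rewrite divr_gt0.
rewrite (_ : box_volume (a - _) _ = p (d / 2)); last first.
  by apply: eq_bigr => i _; rewrite !mxE.
have /hd : ball 0 d (d / 2).
  by rewrite /ball/= sub0r normrN ger0_norm; lra.
by rewrite p0 /= ler_norml; lra.
Qed.

Lemma open_box a b : open [set x : 'rV[R]_n.+1 | forall i, a ord0 i < x ord0 i < b ord0 i].
Proof.
apply/open_rVP => x xab.
pose gap i := Num.min (x ord0 i - a ord0 i) (b ord0 i - x ord0 i).
exists (\big[Num.min/1]_(i < n.+1) gap i).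
  apply: lt_bigmin => // i _; have := xab i.
  by rewrite lt_min !subr_gt0.
move=> y xy i; have := lt_le_trans (xy i) (bigmin_le_cond 1 gap (j := i) isT).
by rewrite lt_min !ltr_norml => /andP[/andP[? ?] /andP[? ?]]; apply/andP; split; lra.
Qed.

Lemma leb_outer_open X (e : R) : (mu X < +oo)%E -> 0 < e ->
  exists U, [/\ open U, X `<=` U & (mu U <= mu X + e%:E)%E].
Proof.
move=> Xoo e0; have e20 : 0 < e / 2 by rewrite divr_gt0.
have fX : mu X \is a fin_num by rewrite ge0_fin_numE// leb_ge0.
have [_ [F [F12 cov] <-] /ltW Fle] := lb_ereal_inf_adherent e20 fX.
have : forall k, {d : R | 0 < d /\
    box_volume ((F k).1 - const_mx d) ((F k).2 + const_mx d) <=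
    box_volume (F k).1 (F k).2 + (e / 2) / (2 ^ k.+1)%:R}.
  move=> k; apply: cid.
  have ek0 : 0 < (e / 2) / (2 ^ k.+1)%:R :> R by rewrite divr_gt0// ltr0n expn_gt0.
  by have [d d0 hd] := box_volume_expand (F k).1 (F k).2 ek0; exists d.
move=> d.
pose a k := (F k).1 - const_mx (sval (d k)).
pose b k := (F k).2 + const_mx (sval (d k)).
exists (\bigcup_k [set x : 'rV[R]_n.+1 | forall i, a k ord0 i < x ord0 i < b k ord0 i]); split.
- by apply: bigcup_open => k _; exact: open_box.
- move=> x /cov[k _ Fkx]; exists k => // i; have := Fkx i; have [d0 _] := svalP (d k).
  by rewrite !mxE => /andP[? ?]; apply/andP; split; lra.
apply: (le_trans (leb_bigcup _)).
apply: (@le_trans _ _ (\sum_(0 <= k <oo)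
   ((box_volume (F k).1 (F k).2)%:E + ((e / 2) / (2 ^ k.+1)%:R)%:E))%E).
  apply: lee_nneseries => k _; first by move=> _; exact: leb_ge0.
  apply: (@le_trans _ _ (mu (box (a k) (b k)))).
    by apply: leb_le => x xab i; have /andP[/ltW -> /ltW ->] := xab i.
  have [d0 dle] := svalP (d k).
  apply: (le_trans (leb_box_le _)); last by rewrite -EFinD lee_fin.
  by move=> i; rewrite !mxE; have := F12 k i; lra.
apply: (le_trans (epsilon_trick _ _ _)).
- move=> k; rewrite lee_fin; apply: prodr_ge0 => i _; by rewrite subr_ge0.
- exact: ltW.
rewrite [e in leRHS]splitr EFinD addeA leeD2r//.
Qed.

(** The open set U consists of the complement of a cube containing E and of an open
set slightly larger than the rest of the cube. *)
Lemma leb_inner_closed E (M e : R) : measurable (E : set T) ->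
  0 < M -> (forall x, E x -> forall i, `|x ord0 i| <= M) -> 0 < e ->
  exists U, [/\ open U, ~` U `<=` E & (mu (E `&` U) <= e%:E)%E].
Proof.
move=> mE M0 EM e0.
pose Q := [set x : 'rV[R]_n.+1 | forall i, `|x ord0 i| <= M].
have Qoo : (mu Q < +oo)%E.
  apply: (@le_lt_trans _ _ (mu (box (const_mx (- M)) (const_mx M)))).
    by apply: leb_le => x Qx i; rewrite !mxE; have := Qx i; rewrite ler_norml.
  apply: (le_lt_trans (leb_box_le _)); last exact: ltry.
  by move=> i; rewrite !mxE; lra.
have QEoo : (mu (Q `\` E) < +oo)%E by apply: le_lt_trans Qoo; apply: leb_le => x [].
have [U [oU QU leU]] := leb_outer_open QEoo e0.
exists (U `|` ~` Q); split.
- apply: openU => //; apply/open_rVP => x /existsNP[i /negP].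
  rewrite -ltNge => Mx; exists (`|x ord0 i| - M); first by rewrite subr_gt0.
  move=> y /(_ i) xy /(_ i) My.
  by have := ler_normD (x ord0 i - y ord0 i) (y ord0 i); rewrite subrK; lra.
- move=> x; rewrite setCU setCK => -[nUx Qx].
  by apply: contrapT => nEx; apply: nUx; apply: QU.
rewrite (_ : E `&` _ = U `&` E); last first.
  apply/seteqP; split=> x [] // => [Ex [//|]|Ux Ex]; last by split => //; left.
  by case; exact: EM.
have Ucara : mu U = (mu (U `&` E) + mu (U `&` ~` E))%E by exact: mE.
have QEf : mu (Q `\` E) \is a fin_num by rewrite ge0_fin_numE// leb_ge0.
rewrite -(leeD2rE _ _ QEf) [leRHS]addeC; apply: le_trans leU; rewrite Ucara leeD2l//.
by apply: leb_le => x QEx; split; [exact: QU|exact: QEx.2].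
Qed.

End regularity.

(** * Erosion of open sets, and diameters *)

Section erosion.
Context {R : realType} {n : nat}.
Local Notation T := (leb_rV R n).
Local Notation mu := (lebesgue_measure_rV R n).
Implicit Types (x y v p : 'rV[R]_n.+1) (A E S U : set 'rV[R]_n.+1).

(** The points at sup-distance at least 1/(m+1) from the complement of U. *)
Definition erosion (m : nat) U : set 'rV[R]_n.+1 :=
  [set p | forall y, (forall i, `|p ord0 i - y ord0 i| < m.+1%:R^-1) -> U y].

Lemma erosion_sub m U : erosion m U `<=` U.
Proof. by move=> p; apply => i; rewrite subrr normr0 invr_gt0 ltr0n. Qed.

Lemma erosion_homo U m k : (m <= k)%N -> erosion m U `<=` erosion k U.
Proof.
move=> mk p pU y py; apply: pU => i.
by apply: lt_le_trans (py i) _; rewrite lef_pV2 ?posrE ?ltr0n// ler_nat ltnS.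
Qed.

Lemma bigcup_erosion U : open U -> \bigcup_m erosion m U = U.
Proof.
move=> /open_rVP oU; apply/seteqP; split=> [p [m _ /erosion_sub//]|p Up].
have [e e0 pe] := oU _ Up; have [m me] := exists_invS_lt e0.
by exists m => // y py; apply: pe => i; apply: lt_trans me.
Qed.

Lemma measurable_erosion m U : measurable (erosion m U : set T).
Proof.
rewrite -[erosion m U]setCK; apply: measurableC; apply: measurable_open.
apply/open_rVP => p /existsNP[y /not_implyP[py nUy]].
pose gap i := m.+1%:R^-1 - `|p ord0 i - y ord0 i|.
exists (\big[Num.min/1]_(i < n.+1) gap i).
  by apply: lt_bigmin => // i _; rewrite subr_gt0.
move=> q pq qU; apply: nUy; apply: qU => i.
have := lt_le_trans (pq i) (bigmin_le_cond 1 gap (j := i) isT).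
rewrite ltrBrDr; apply: le_lt_trans.
by rewrite (distrC (p ord0 i) (q ord0 i)) ler_distD.
Qed.

(** Erosions increase to U; a strict inequality for E `&` U survives for some
erosion, which leaves room to move a set or to fit a grid cell inside U. *)
Lemma lt_leb_erosion (c : \bar R) E U : measurable (E : set T) -> open U ->
  (c < mu (E `&` U))%E -> exists m, (c < mu (E `&` erosion m U))%E.
Proof.
move=> mE oU cE; apply: contrapT => /forallNP h.
have mF m : measurable (E `&` erosion m U : set T).
  by apply: measurableI => //; exact: measurable_erosion.
have hU : \bigcup_m (E `&` erosion m U) = E `&` U.
  by rewrite -setI_bigcupr bigcup_erosion.
have hcvg : (mu \o (fun m => E `&` erosion m U)) x @[x --> \oo] --> mu (E `&` U).
  rewrite -hU; apply: nondecreasing_cvg_mu => //.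
    by rewrite hU; apply: measurableI => //; exact: measurable_open.
  by move=> m k mk; apply/subsetPset; apply: setIS; apply: erosion_homo.
move: cE; rewrite ltNge => /negP; apply.
rewrite -(cvg_lim _ hcvg)//; apply: lime_le; first by apply/cvg_ex; exists (mu (E `&` U)).
by apply: nearW => m /=; rewrite leNgt; apply/negP; exact: h.
Qed.

End erosion.

Section heavy.
Context {R : realType} {n : nat}.
Local Notation T := (leb_rV R n).
Local Notation mu := (lebesgue_measure_rV R n).
Implicit Types (x y v p : 'rV[R]_n.+1) (A E S U F : set 'rV[R]_n.+1) (r alpha : R).

Lemma coord_le_enorm x i : `|x ord0 i| <= enorm x.
Proof.
rewrite /enorm -sqrtr_sqr; apply: ler_wsqrtr.
by rewrite (bigD1 i)//= lerDl; apply: sumr_ge0 => j _; exact: sqr_ge0.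
Qed.

Lemma coord_lt_diam S r x y i : (diam S < r%:E)%E -> S x -> S y ->
  `|x ord0 i - y ord0 i| < r.
Proof.
move=> Sr Sx Sy; rewrite -lte_fin; apply: le_lt_trans Sr.
apply: (@le_trans _ _ (enorm (x - y))%:E).
  by rewrite lee_fin; have := coord_le_enorm (x - y) i; rewrite !mxE.
by apply: ereal_sup_ubound; exists (x, y).
Qed.

Lemma diam_ge0 S x : S x -> (0 <= diam S)%E.
Proof.
move=> Sx; apply: (@le_trans _ _ (enorm (x - x))%:E).
  by rewrite lee_fin /enorm sqrtr_ge0.
by apply: ereal_sup_ubound; exists (x, x).
Qed.

Lemma diam_translate v S : diam (translate v S) = diam S.
Proof.
rewrite /diam; congr ereal_sup; apply/seteqP; split=> t [[x y] /=].
  move=> [/= [x' Sx' <-] [y' Sy' <-]] <-; exists (x', y') => //=.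
  by rewrite opprD addrACA subrr add0r.
move=> [/= Sx Sy] <-; exists (v + x, v + y).
  by split; [exists x|exists y].
by rewrite /= opprD addrACA subrr add0r.
Qed.

Context {B : basis_family R n}.
Hypothesis hB : differentiation_basis B.

Lemma basis_measure x S : B x S -> (0 < mu S < +oo)%E.
Proof.
have [_ hS _] := hB x; move=> /hS[bS oS Sx]; rewrite leb_bounded// andbT.
by apply: leb_open_gt0 => //; exists x.
Qed.

Lemma measurable_basis x S : B x S -> measurable (S : set T).
Proof. by have [_ hS _] := hB x => /hS[_ oS _]; exact: measurable_open. Qed.

End heavy.

(** * Points where a set has high density *)

Section heavy_points.
Context {R : realType} {n : nat} {B : basis_family R n}.
Local Notation T := (leb_rV R n).
Local Notation mu := (lebesgue_measure_rV R n).
Implicit Types (x y v p : 'rV[R]_n.+1) (A E S U F : set 'rV[R]_n.+1) (r alpha : R).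
Hypothesis hB : differentiation_basis B.

Definition heavy r alpha E : set 'rV[R]_n.+1 :=
  [set x | exists S, [/\ B x S, (diam S < r%:E)%E &
    (alpha%:E * mu S < mu (E `&` S))%E]].

Lemma average_indic x E S : measurable (E : set T) -> B x S ->
  average \1_E S = ((fine (mu S))^-1%:E * mu (E `&` S))%E.
Proof.
move=> mE BS; rewrite /average integral_indic//.
exact: (measurable_basis hB BS).
Qed.

Lemma lt_average x alpha E S : measurable (E : set T) -> B x S ->
  (alpha%:E < average \1_E S)%E = (alpha%:E * mu S < mu (E `&` S))%E.
Proof.
move=> mE BS; rewrite (average_indic mE BS).
have /andP[S0 Soo] := basis_measure hB BS.
have fS : mu S \is a fin_num by rewrite ge0_fin_numE// leb_ge0.
have fES : mu (E `&` S) \is a fin_num.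
  by rewrite ge0_fin_numE ?leb_ge0//; apply: le_lt_trans Soo; apply: leb_le => y [].
rewrite -(fineK fS) -(fineK fES) -!EFinM !lte_fin/=.
by rewrite ltr_pdivlMl 1?mulrC// fine_gt0 ?S0.
Qed.

(** Heavy points describe superlevel sets by an inequality free of quotients, which
is monotone, local and covariant under translation by inspection. *)
Lemma heavyE r alpha E : measurable (E : set T) ->
  [set x | (alpha%:E < maximal (small_basis B r) \1_E x)%E] = heavy r alpha E.
Proof.
move=> mE; have nE : (fun y : T => `|\1_E y|) = \1_E :> (T -> R).
  by apply/funext => y; rewrite ger0_norm.
apply/seteqP; split=> x /=; rewrite /maximal nE.
  move=> /ereal_sup_gt[_ [S [BS Sr] <-]]; rewrite (lt_average _ mE BS) => h.
  by exists S.
move=> [S [BS Sr h]]; rewrite -(lt_average _ mE BS) in h.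
by apply: (lt_le_trans h); apply: ereal_sup_ubound; exists S.
Qed.

Lemma sub_heavy r alpha E F : E `<=` F -> heavy r alpha E `<=` heavy r alpha F.
Proof.
move=> EF x [S [BS Sr h]]; exists S; split => //; apply: (lt_le_trans h).
by apply: leb_le; exact: setSI.
Qed.

Lemma heavy_le r r' alpha E : r <= r' -> heavy r alpha E `<=` heavy r' alpha E.
Proof.
move=> rr x [S [BS Sr h]]; exists S; split => //; apply: (lt_le_trans Sr).
by rewrite lee_fin.
Qed.

(** Sets of diameter < r around x cannot see E beyond distance r. *)
Lemma heavy_local r alpha E F x :
  (forall y, (forall i, `|x ord0 i - y ord0 i| < r) -> F y) ->
  heavy r alpha E x -> heavy r alpha (E `&` F) x.
Proof.
move=> xF [S [BS Sr h]]; exists S; split => //.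
rewrite (_ : _ `&` S = E `&` S)//; apply/seteqP; split=> y; first by move=> [[]].
move=> [Ey Sy]; split => //; split => //; apply: xF => i.
have [_ hS _] := hB x; have [_ _ Sx] := hS _ BS.
exact: (coord_lt_diam i Sr).
Qed.

(** When E is null it is left out of the supremum in the Tauberian constant, but
then it has no heavy points. *)
Lemma leb_heavy r alpha (C : R) E : 0 <= alpha -> measurable (E : set T) ->
  (mu E < +oo)%E -> (tauberian (small_basis B r) alpha <= C%:E)%E ->
  (mu (heavy r alpha E) <= C%:E * mu E)%E.
Proof.
move=> a0 mE Eoo hC; have [E0|E0] := eqVneq (mu E) 0%E.
  rewrite (_ : heavy _ _ _ = set0) ?measure0 ?E0 ?mule0//.
  rewrite -subset0 => x [S [BS Sr]]; rewrite ltNge; apply/negP; rewrite negbK.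
  apply: (@le_trans _ _ (mu E)); first by apply: leb_le => y [].
  by rewrite E0 mule_ge0// lee_fin.
have E0' : (0 < mu E)%E by rewrite lt_neqAle eq_sym E0 leb_ge0.
have fE : mu E \is a fin_num by rewrite ge0_fin_numE// leb_ge0.
have := le_trans _ hC; move=> /(_ ((fine (mu E))^-1%:E * mu (heavy r alpha E))%E).
move=> /(_ _)/wrap[].
  apply: ereal_sup_ubound; exists E; first by split => //; rewrite E0'.
  by rewrite heavyE.
have fE0 : 0 < fine (mu E) by rewrite fine_gt0// E0'.
by rewrite lee_pdivrMl// fineK// muleC.
Qed.

Lemma heavy_tauberian r alpha (c : R) :
  tauberian (small_basis B r) alpha = +oo%E ->
  exists E, [/\ measurable (E : set T), (mu E < +oo)%E &
    (c%:E * mu E < mu (heavy r alpha E))%E].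
Proof.
move=> hoo; have : (c%:E < tauberian (small_basis B r) alpha)%E by rewrite hoo ltry.
move=> /ereal_sup_gt[_ [E [mE /andP[E0 Eoo]] <-]]; rewrite heavyE// => h.
have fE : mu E \is a fin_num by rewrite ge0_fin_numE// leb_ge0.
have fE0 : 0 < fine (mu E) by rewrite fine_gt0// E0.
exists E; split => //; move: h.
by rewrite lte_pdivlMl// fineK// muleC.
Qed.

Hypothesis hinv : translation_invariant B.

Lemma basis_translate v x S : B x S -> B (v + x) (translate v S).
Proof.
move=> BS; have B0 : B 0 (translate (- x) S).
  apply/(hinv x); suff -> : [set x + y | y in translate (- x) S] = S by [].
  by have := translateK (- x) S; rewrite opprK.
have /(hinv (v + x)) := B0.
suff -> : [set v + x + y | y in translate (- x) S] = translate v S by [].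
apply/funext => p; rewrite [LHS]translateE !translateE.
by congr (S _); rewrite opprK opprD addrA subrK.
Qed.

Lemma heavy_translate v r alpha E :
  heavy r alpha (translate v E) = translate v (heavy r alpha E).
Proof.
have sub w F : translate w (heavy r alpha F) `<=` heavy r alpha (translate w F).
  move=> _ [x [S [BS Sr h]] <-]; exists (translate w S); split.
  - exact: basis_translate.
  - by rewrite diam_translate.
  rewrite leb_translate (_ : _ `&` _ = translate w (F `&` S)) ?leb_translate//.
  by apply/funext => p; rewrite /setI /mkset !translateE.
apply/seteqP; split; last exact: sub.
move=> x hx; rewrite translateE -[E](translateK v); apply: sub.
by exists x => //; rewrite addrC.
Qed.

(** The inequality alpha |S| < |E `&` S| persists when S on the right is replaced by
a slight erosion of S. That erosion lies in every translate of S by a small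
vector, and these translates have measure |S| and belong to B at nearby points. *)
Lemma open_heavy r alpha E : measurable (E : set T) -> open (heavy r alpha E).
Proof.
move=> mE; apply/open_rVP => x [S [BS Sr h]].
have [_ hS _] := hB x; have [_ oS _] := hS _ BS.
have [m hm] := lt_leb_erosion mE oS h.
exists m.+1%:R^-1; first by rewrite invr_gt0 ltr0n.
move=> y xy; exists (translate (y - x) S); split.
- by have := basis_translate (y - x) BS; rewrite subrK.
- by rewrite diam_translate.
rewrite leb_translate; apply: (lt_le_trans hm); apply: leb_le => p [Ep Sp].
split => //; rewrite translateE; apply: Sp => i; rewrite !mxE.
rewrite (_ : _ - _ = y ord0 i - x ord0 i); last by lra.
by rewrite distrC; exact: xy.
Qed.

End heavy_points.

(** * Tauberian bounds imply density *)

Section tauberian_density.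
Context {R : realType} {n : nat} {B : basis_family R n}.
Local Notation T := (leb_rV R n).
Local Notation mu := (lebesgue_measure_rV R n).
Implicit Types (x y v p : 'rV[R]_n.+1) (A E S U F N : set 'rV[R]_n.+1) (r alpha : R).
Hypothesis hB : differentiation_basis B.

(** For points outside E, failure of the density property at level alpha. *)
Definition exceptional alpha E : set 'rV[R]_n.+1 :=
  [set x | ~ E x /\ forall r, 0 < r -> heavy (B := B) r alpha E x].

(** A point outside E has a neighbourhood avoiding the closed set ~` U inside E, so
its heaviness at small radii comes from E `&` U alone, whose measure is at most
e / C. *)
Lemma exceptional_null_bounded alpha r E (M : R) : 0 <= alpha -> 0 < r ->
  (tauberian (small_basis B r) alpha < +oo)%E -> measurable (E : set T) ->
  0 < M -> (forall x, E x -> forall i, `|x ord0 i| <= M) ->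
  mu (exceptional alpha E) = 0%E.
Proof.
move=> a0 r0 Coo mE M0 EM.
have [C C0 hC] : exists2 C : R, 0 < C & (tauberian (small_basis B r) alpha <= C%:E)%E.
  case: tauberian Coo => [c|//|] _; last by exists 1; rewrite ?leNye.
  by exists (Num.max c 1); rewrite ?lee_fin ?lt_max ?ltr01 ?orbT// le_max lexx.
apply/eqP; rewrite eq_le leb_ge0 andbT; apply/lee_addgt0Pr => e e0; rewrite add0e.
have [U [oU UE leU]] := leb_inner_closed mE M0 EM (divr_gt0 e0 C0).
have mEU : measurable (E `&` U : set T).
  by apply: measurableI => //; exact: measurable_open.
apply: (@le_trans _ _ (mu (heavy (B := B) r alpha (E `&` U)))).
  apply: leb_le => x [nEx hx].
  have /(_ x)[|d d0 xd] := (open_rVP U).1 oU.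
    by apply: contrapT => nUx; apply: nEx; exact: UE.
  have := hx (Num.min r d); rewrite lt_min r0 => /(_ d0) h.
  apply: (@heavy_le _ _ _ (Num.min r d)); first by rewrite ge_min lexx.
  apply: (heavy_local hB) => // y xy; apply: xd => i; apply: (lt_le_trans (xy i)).
  by rewrite ge_min lexx orbT.
apply: (le_trans (leb_heavy hB a0 mEU _ hC)).
  by apply: (le_lt_trans leU); exact: ltry.
apply: (le_trans (lee_wpmul2l _ leU)); first by rewrite lee_fin ltW.
by rewrite -EFinM lee_fin mulrC divfK// gt_eqF.
Qed.

Lemma exceptional_null alpha r E : 0 <= alpha -> 0 < r ->
  (tauberian (small_basis B r) alpha < +oo)%E -> measurable (E : set T) ->
  mu (exceptional alpha E) = 0%E.
Proof.
move=> a0 r0 Coo mE.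
pose K (m : nat) := [set x : 'rV[R]_n.+1 | forall i,
  (const_mx (- m.+1%:R) : 'rV[R]_n.+1) ord0 i < x ord0 i <
  (const_mx m.+1%:R : 'rV[R]_n.+1) ord0 i].
have mEK m : measurable (E `&` K m : set T).
  by apply: measurableI => //; apply: measurable_open; exact: open_box.
apply/eqP; rewrite eq_le leb_ge0 andbT.
apply: (@le_trans _ _ (mu (\bigcup_m exceptional alpha (E `&` K m)))).
  apply: leb_le => x [nEx hx].
  (* The cube K m leaves a margin 1 around x, enough for sets of diameter < 1. *)
  pose m := Num.bound (\sum_(i < n.+1) `|x ord0 i|).
  exists m => //; split; first by case.
  have xm i : `|x ord0 i| < m%:R.
    apply: (le_lt_trans _ (archi_boundP _)); last by apply: sumr_ge0.
    by rewrite (bigD1 i)//= lerDl; apply: sumr_ge0.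
  move=> s s0; apply: (@heavy_le _ _ _ (Num.min s 1)); first by rewrite ge_min lexx.
  apply: (heavy_local hB); last by apply: hx; rewrite lt_min s0 ltr01.
  move=> y xy i; have := xy i; have := xm i.
  rewrite lt_min !mxE -natr1 !ltr_norml.
  by move=> /andP[? ?] /andP[_ /andP[? ?]]; apply/andP; split; lra.
apply: (le_trans (leb_bigcup _)); rewrite eseries0// => m _ _.
apply: (exceptional_null_bounded a0 r0 Coo (mEK m) (M := m.+1%:R)) => //.
move=> x [_ Kx] i; have := Kx i; rewrite !mxE => /andP[/ltW ? /ltW ?].
by rewrite ler_norml; apply/andP.
Qed.

Lemma outer_null_measurable N : mu N = 0%E -> measurable (N : set T).
Proof.
move=> N0; apply: (@le_caratheodory_measurable _ _ (lebesgue_rV R n)) => X.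
rewrite -[leRHS]add0e; apply: leeD; last by apply: leb_le => x [].
by rewrite -N0; apply: leb_le => x [].
Qed.

Lemma diam_near r (S_ : nat -> set 'rV[R]_n.+1) : 0 < r ->
  diam (S_ j) @[j --> \oo] --> 0%E -> \forall j \near \oo, (diam (S_ j) < r%:E)%E.
Proof.
move=> r0 /fine_cvgP[fin /cvgrPdist_lt/(_ _ r0) lim].
near=> j; have fj : diam (S_ j) \is a fin_num by near: j.
have : `|0 - fine (diam (S_ j))| < r by near: j.
by rewrite sub0r normrN -{2}(fineK fj) lte_fin; apply: le_lt_trans; exact: ler_norm.
Unshelve. all: by end_near. Qed.

(** The last identity reduces the density property at points of E to points outside
the complement of E. *)
Lemma average_bounds x E S : measurable (E : set T) -> B x S ->
  [/\ average \1_E S \is a fin_num, (0 <= average \1_E S)%E &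
    average \1_E S = (1 - average \1_(~` E) S)%E].
Proof.
move=> mE BS; have mS := measurable_basis hB BS.
have mCE : measurable (~` E : set T) by exact: measurableC.
rewrite !(average_indic hB _ BS)//.
have /andP[S0 Soo] := basis_measure hB BS.
have fin F : mu (F `&` S) \is a fin_num.
  by rewrite ge0_fin_numE ?leb_ge0//; apply: le_lt_trans Soo; apply: leb_le => y [].
have fS : mu S \is a fin_num by rewrite ge0_fin_numE// leb_ge0.
have s0 : 0 < fine (mu S) by rewrite fine_gt0// S0.
have split : mu S = (mu (E `&` S) + mu (~` E `&` S))%E.
  by rewrite setIC [X in (_ + mu X)%E]setIC; exact: mE.
split; first by rewrite fin_numM.
  by rewrite mule_ge0 ?leb_ge0// lee_fin invr_ge0 ltW.
rewrite -(fineK (fin E)) -(fineK (fin (~` E))) -!EFinM -EFinB; congr _%:E.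
have -> : fine (mu (E `&` S)) = fine (mu S) - fine (mu (~` E `&` S)).
  by rewrite split fineD// addrK.
by rewrite mulrBr mulVf// gt_eqF.
Qed.

Lemma average_cvg0 x E (S_ : nat -> set 'rV[R]_n.+1) : measurable (E : set T) ->
  (forall k : nat, ~ forall r, 0 < r -> heavy (B := B) r k.+2%:R^-1 E x) ->
  (forall j, B x (S_ j)) -> diam (S_ j) @[j --> \oo] --> 0%E ->
  average \1_E (S_ j) @[j --> \oo] --> 0%E.
Proof.
move=> mE good BS dS; apply/fine_cvgP; split.
  by apply: nearW => j; have [] := average_bounds mE (BS j).
apply/cvgrPdist_le => e e0; have [k ke] := exists_invS_lt e0.
have /existsNP[r /not_implyP[r0 nh]] := good k.
have := diam_near r0 dS; apply: filterS => j djr.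
have [fj a0 _] := average_bounds mE (BS j).
rewrite sub0r normrN ger0_norm; last by rewrite fine_ge0.
rewrite -lee_fin fineK// leNgt; apply/negP => h; apply: nh; exists (S_ j); split => //.
rewrite -(lt_average hB _ mE (BS j)); apply: le_lt_trans h; rewrite lee_fin.
by apply: (le_trans _ (ltW ke)); rewrite lef_pV2 ?posrE ?ltr0n// ler_nat.
Qed.

Lemma tauberian_density :
  (forall alpha, 0 < alpha < 1 ->
     exists r : R, 0 < r /\ (tauberian (small_basis B r) alpha < +oo)%E) ->
  density_basis B.
Proof.
move=> hT E mE.
have mCE : measurable (~` E : set T) by exact: measurableC.
have null k F : measurable (F : set T) -> mu (exceptional k.+2%:R^-1 F) = 0%E.
  move=> mF; have [|r [r0 Coo]] := hT k.+2%:R^-1.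
    by rewrite invr_gt0 ltr0n invf_lt1 ?ltr0n// ltr1n.
  by apply: (exceptional_null _ r0 Coo mF); rewrite invr_ge0 ler0n.
pose N := \bigcup_(k in [set: nat])
  (exceptional k.+2%:R^-1 E `|` exceptional k.+2%:R^-1 (~` E)).
have N0 : mu N = 0%E.
  apply/eqP; rewrite eq_le leb_ge0 andbT; apply: (le_trans (leb_bigcup _)).
  rewrite eseries0// => k _ _; apply/eqP; rewrite eq_le leb_ge0 andbT.
  by apply: (le_trans (leb_setU _ _)); rewrite !null// adde0.
exists N; split => //; first exact: outer_null_measurable.
move=> x /= nP; apply: contrapT => nN; apply: nP => S_ BS dS.
have good k F : measurable (F : set T) -> ~ F x ->
    (F = E \/ F = ~` E) -> ~ forall r, 0 < r -> heavy (B := B) r k.+2%:R^-1 F x.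
  by move=> mF nF FE hF; apply: nN; exists k => //; case: FE => FE; [left|right];
    rewrite -FE.
have [Ex|nEx] := pselect (E x); last first.
  rewrite indicE memNset//; apply: average_cvg0 => // k.
  by apply: good => //; left.
rewrite indicE mem_set//.
rewrite (_ : (fun j => average \1_E (S_ j)) =
    (fun j => 1 - average \1_(~` E) (S_ j))%E); last first.
  by apply/funext => j; have [] := average_bounds mE (BS j).
rewrite -[X in _ --> X]sube0; apply: cvgeB => //; first exact: cvg_cst.
by apply: average_cvg0 => // k; apply: good => //; right.
Qed.

End tauberian_density.

(** * Localization to the unit cell *)

Section localization.
Context {R : realType} {n : nat}.
Local Notation T := (leb_rV R n).
Local Notation mu := (lebesgue_measure_rV R n).
Local Notation Q0 := (cell (R := R) (n := n) 0 0).
Implicit Types (x y v p : 'rV[R]_n.+1) (A E S U F W : set 'rV[R]_n.+1).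
Implicit Types (r alpha : R) (z : 'rV[int]_n.+1).

(** A is split along the sets F i one at a time, by their Caratheodory property. *)
Lemma leb_sum_disjoint (I : eqType) (s : seq I) (F : I -> set 'rV[R]_n.+1) A :
  uniq s -> (forall i, measurable (F i : set T)) ->
  (forall i j x, F i x -> F j x -> i = j) ->
  (\sum_(i <- s) mu (A `&` F i) <= mu (A `&` [set x | exists2 i, i \in s & F i x]))%E.
Proof.
move=> us mF dF; elim: s us => [_|i s IH /= /andP[nis us]].
  by rewrite big_nil leb_ge0.
rewrite big_cons; set U := [set x | _].
have -> : mu (A `&` U) = (mu (A `&` U `&` F i) + mu (A `&` U `&` ~` F i))%E by exact: mF.
apply: leeD.
  apply: leb_le => x [Ax Fix]; split => //; split => //.
  by exists i; rewrite ?inE ?eqxx.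
apply: (le_trans (IH us)); apply: leb_le => x [Ax [j js Fjx]].
split; first by split => //; exists j => //; rewrite inE js orbT.
by move=> Fix; move: nis; rewrite (dF _ _ _ Fix Fjx) js.
Qed.

(** The unit cells shifted by z, indexed by natural numbers through the encoding of
integer vectors; the indices that encode nothing contribute the empty set. *)
Definition unit_cell z (k : nat) : set 'rV[R]_n.+1 :=
  if pickle_inv k is Some w then cell 0 (w + z) else set0.

Lemma cell_inj N z z' x : cell N z x -> cell N z' x -> z = z'.
Proof. by move=> <- <-. Qed.

Lemma tiling_sum z E : (\sum_(0 <= k <oo) mu (E `&` unit_cell z k) <= mu E)%E.
Proof.
apply: lime_le; first by apply: is_cvg_nneseries => k _ _; exact: leb_ge0.
apply: nearW => m.
apply: le_trans (leb_sum_disjoint (s := index_iota 0 m) (F := unit_cell z) E _ _ _) _.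
- exact: iota_uniq.
- move=> k; rewrite /unit_cell; case: pickle_inv => [w|]; last exact: measurable0.
  exact: measurable_cell.
- move=> i j x; rewrite /unit_cell.
  have := pickle_invK (T := 'rV[int]_n.+1) i; have := pickle_invK (T := 'rV[int]_n.+1) j.
  case: pickle_inv => [w' /= <-|//]; case: pickle_inv => [w /= <-|//] xw xw'.
  by congr pickle; apply: (addIr z); exact: cell_inj xw xw'.
- by apply: leb_le => x [].
Qed.

Lemma cell_tiling E : (mu E <= \sum_(0 <= k <oo) mu (E `&` unit_cell 0 k))%E.
Proof.
apply: le_trans (leb_bigcup _); apply: leb_le => x Ex.
exists (pickle (cell_index 0 x)) => //; split => //.
by rewrite /unit_cell pickleK_inv addr0.
Qed.

Definition neighbour (w : {ffun 'I_n.+1 -> 'I_3}) : 'rV[int]_n.+1 :=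
  \row_i ((w i)%:Z - 1).

Lemma cell_neighbour z x y : cell 0 z x ->
  (forall i, `|x ord0 i - y ord0 i| < 1) -> exists w, cell 0 (z + neighbour w) y.
Proof.
move=> xz xy.
have h i : exists k : 'I_3, Num.floor (y ord0 i) = z ord0 i + (k%:Z - 1).
  have <- : Num.floor (x ord0 i) = z ord0 i by rewrite -xz mxE mul1r.
  have /andP[x1 x2] := floor_itv (x ord0 i); have /andP[y1 y2] := floor_itv (y ord0 i).
  move: x1 x2 y1 y2; set f := Num.floor _; set g := Num.floor _ => x1 x2 y1 y2.
  have := xy i; rewrite ltr_norml => /andP[xy1 xy2].
  have gf : (g < f + 2)%R.
    by rewrite -(ltr_int R) intrD; move: x2 y2; rewrite !intrD; lra.
  have fg : (f < g + 2)%R.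
    by rewrite -(ltr_int R) intrD; move: x2 y2; rewrite !intrD; lra.
  have lt3 : (`|(g - f + 1)%R| < 3)%N by lia.
  by exists (Ordinal lt3) => /=; lia.
exists [ffun i => projT1 (cid (h i))]; apply/rowP => i; rewrite !mxE ffunE mul1r.
exact: projT2 (cid (h i)).
Qed.

Context {B : basis_family R n}.
Hypothesis hB : differentiation_basis B.
Hypothesis hinv : translation_invariant B.
Local Notation heavy := (heavy (B := B)).

(** If every unit cell satisfied |heavy(E) `&` cell| <= c |E near the cell|, summing
would give |heavy(E)| <= c 3^(n+1) |E|, because each point of E is near at most
3^(n+1) cells; r <= 1 makes the neighbouring cells suffice. A cell that violates
this is moved to the origin. *)
Lemma heavy_localize r alpha (c : R) E : r <= 1 -> 0 <= c ->
  measurable (E : set T) -> (mu E < +oo)%E ->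
  ((c * (3 ^ n.+1)%:R)%:E * mu E < mu (heavy r alpha E))%E ->
  exists F, [/\ measurable (F : set T), (mu F < +oo)%E &
    (c%:E * mu F < mu (heavy r alpha F `&` Q0))%E].
Proof.
move=> r1 c0 mE Eoo; apply: contraPP => /forallNP hF; apply/negP; rewrite -leNgt.
pose near_cell z := \bigcup_(w in [set: {ffun 'I_n.+1 -> 'I_3}])
  cell (R := R) 0 (z + neighbour w).
have mnear z : measurable (near_cell z : set T).
  apply: fin_bigcup_measurable; first exact: finite_finset.
  by move=> w _; exact: measurable_cell.
have local z : (mu (heavy r alpha E `&` cell 0 z) <= c%:E * mu (E `&` near_cell z))%E.
  pose g := - grid_point (R := R) 0 z; pose F := translate g (E `&` near_cell z).
  have mF : measurable (F : set T).
    by apply: measurable_translate; exact: measurableI.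
  have Foo : (mu F < +oo)%E.
    by rewrite leb_translate; apply: le_lt_trans Eoo; apply: leb_le => x [].
  have := hF F; rewrite -[mu (E `&` _)](leb_translate g) -/F => nF.
  rewrite leNgt; apply/negP => h; apply: nF; split => //; apply: (lt_le_trans h).
  rewrite -(leb_translate g); apply: leb_le => _ [x [hx xz] <-]; split.
    rewrite heavy_translate//; exists x => //; apply: heavy_local => // y xy.
    have [w yw] : exists w, cell 0 (z + neighbour w) y.
      by apply: cell_neighbour xz _ => i; apply: lt_le_trans (xy i) r1.
    by exists w.
  have -> : Q0 = cell 0 (- z + z) by rewrite addNr.
  rewrite -translate_cell; exists x => //; congr (_ + _).
  by apply/rowP => i; rewrite !mxE mulrNz mulNr.
apply: (le_trans (cell_tiling _)).
apply: (@le_trans _ _ (\sum_(0 <= k <oo)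
    (c%:E * \sum_(w : {ffun 'I_n.+1 -> 'I_3}) mu (E `&` unit_cell (neighbour w) k)))%E).
  apply: lee_nneseries => k _; first by move=> _; exact: leb_ge0.
  rewrite /unit_cell; case: pickle_inv => [z|]; last first.
    by rewrite setI0 measure0 mule_ge0//; apply: sume_ge0.
  rewrite addr0; apply: (le_trans (local z)); rewrite lee_wpmul2l//.
  apply: leb_bigcup_seq => x [Ex [w _ xw]]; exists w; first exact: mem_index_enum.
  by split.
rewrite nneseriesZl; last by move=> k _; apply: sume_ge0 => w _; exact: leb_ge0.
rewrite EFinM -muleA lee_wpmul2l// nneseries_sum; last by move=> *; exact: leb_ge0.
apply: (@le_trans _ _ (\sum_(w : {ffun 'I_n.+1 -> 'I_3}) mu E)%E).
  by apply: lee_sum => w _; exact: tiling_sum.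
have fE : mu E \is a fin_num by rewrite ge0_fin_numE// leb_ge0.
rewrite -(fineK fE) sumEFin sumr_const -EFinM lee_fin.
by rewrite card_ffun !card_ord mulr_natl.
Qed.

End localization.

(** * Covering by translates *)

Section covering.
Context {R : realType} {n : nat}.
Local Notation T := (leb_rV R n).
Local Notation mu := (lebesgue_measure_rV R n).
Local Notation Q0 := (cell (R := R) (n := n) 0 0).
Implicit Types (x y v p : 'rV[R]_n.+1) (A E O U F W : set 'rV[R]_n.+1).

Lemma leb_Q0_gt0 : (0 < mu Q0)%E.
Proof.
pose a : 'rV[R]_n.+1 := const_mx 0; pose b : 'rV[R]_n.+1 := const_mx 1.
apply: (@lt_le_trans _ _ (mu [set x | forall i, a ord0 i < x ord0 i < b ord0 i])).
  apply: leb_open_gt0; first exact: open_box.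
  by exists (const_mx 2^-1) => i; rewrite !mxE; apply/andP; split; lra.
apply: leb_le => x xab; apply/cell_coord => i; have := xab i; rewrite !mxE.
by rewrite add0r !divr1 => /andP[/ltW -> ->].
Qed.

Lemma leb_Q0_le1 : (mu Q0 <= 1)%E.
Proof. by apply: (le_trans (leb_cell_le _ _)); rewrite invr1 expr1n. Qed.

Lemma leb_sub_Q0 W : W `<=` Q0 -> mu W \is a fin_num.
Proof.
move=> WQ; rewrite ge0_fin_numE ?leb_ge0//; apply: (le_lt_trans (leb_le WQ)).
by apply: le_lt_trans leb_Q0_le1 _; exact: ltry.
Qed.

(** Integer vectors with entries in [-m, N - m), given as a finite type. With m = 0
they index the cells in Q0, with N = 2m the shifts that carry one such cell to
another. *)
Definition natrow N m (c : {ffun 'I_n.+1 -> 'I_N}) : 'rV[int]_n.+1 :=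
  \row_i ((c i)%:Z - m%:Z).

Lemma cell_index_Q0 N x : Q0 x ->
  exists c : {ffun 'I_n.+1 -> 'I_N.+1}, cell N (natrow 0 c) x.
Proof.
move=> /cell_coord Qx.
have h i : exists k : 'I_N.+1, Num.floor (N.+1%:R * x ord0 i) = k%:Z.
  have := Qx i; rewrite !mxE add0r !divr1 => /andP[x0 x1].
  have f0 : 0 <= Num.floor (N.+1%:R * x ord0 i) by rewrite floor_ge0 mulr_ge0.
  have f1 : (Num.floor (N.+1%:R * x ord0 i) < N.+1%:Z)%R.
    rewrite -(ltr_int R); apply: (le_lt_trans (floor_le _)).
    by rewrite -[ltRHS]mulr1 ltr_pM2l ?ltr0n.
  have lt : (`|Num.floor (N.+1%:R * x ord0 i)| < N.+1)%N by lia.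
  by exists (Ordinal lt) => /=; lia.
exists [ffun i => projT1 (cid (h i))]; apply/rowP => i; rewrite !mxE ffunE subr0.
exact: projT2 (cid (h i)).
Qed.

(** Approximate O `&` Q0 from inside by cells of a grid of step 1/(N+1). For one such
cell, the (2(N+1))^(n+1) grid shifts move it over all of Q0, so the overlaps
with W add up to at least |W|; summing over the cells in O bounds the average
overlap from below. The factor 2^-(n+1) is the ratio of the number of cells in
Q0 to the number of shifts, and one more factor 1/2 pays for the approximation. *)
Lemma exists_overlap O W : open O -> W `<=` Q0 ->
  exists v, (((2^-1) ^+ n.+2)%:E * mu (O `&` Q0) * mu W <= mu (W `&` translate v O))%E.
Proof.
move=> oO WQ; apply: contrapT => /forallNP small.
have fW := leb_sub_Q0 WQ.
have fO : mu (O `&` Q0) \is a fin_num by apply: leb_sub_Q0 => x [].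
set a := fine (mu (O `&` Q0)); set w := fine (mu W).
have Oa : mu (O `&` Q0) = a%:E by rewrite /a fineK.
have Ww : mu W = w%:E by rewrite /w fineK.
have {}small v : (mu (W `&` translate v O) < ((2^-1) ^+ n.+2 * a * w)%:E)%E.
  by rewrite ltNge; apply/negP => h; apply: (small v); rewrite Oa Ww -!EFinM.
have a0 : 0 <= a by rewrite fine_ge0// leb_ge0.
have w0 : 0 <= w by rewrite fine_ge0// leb_ge0.
have aw0 : 0 < a * w.
  have := le_lt_trans (leb_ge0 _) (small 0).
  by rewrite lte_fin -mulrA pmulr_rgt0 ?exprn_gt0// invr_gt0.
have {}a0 : 0 < a.
  rewrite lt_neqAle a0 eq_sym andbT.
  by apply: contraTneq aw0 => ->; rewrite mul0r ltxx.
have {}w0 : 0 < w by rewrite -(pmulr_rgt0 _ a0).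
(* The erosion of depth 1/(N+1) meets only grid cells that lie inside O. *)
have [N hN] : exists N, ((a / 2)%:E < mu (Q0 `&` erosion N O))%E.
  apply: lt_leb_erosion => //; first exact: measurable_cell.
  by rewrite setIC Oa lte_fin; lra.
pose C := [pred c : {ffun 'I_n.+1 -> 'I_N.+1} |
  `[< cell (R := R) N (natrow 0 c) `<=` O >]].
pose s := [seq c <- index_enum {ffun 'I_n.+1 -> 'I_N.+1} | C c].
have many : a / 2 < (size s)%:R * (N.+1%:R^-1) ^+ n.+1.
  rewrite -lte_fin; apply: (lt_le_trans hN).
  apply: (@le_trans _ _ (\sum_(c <- s) mu (cell N (natrow 0 c)))%E).
    apply: leb_bigcup_seq => x [Qx xO]; have [c xc] := cell_index_Q0 N Qx.
    exists c => //; rewrite mem_filter mem_index_enum andbT; apply/asboolP => y yc.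
    by apply: xO => i; exact: cell_diff xc yc.
  apply: (@le_trans _ _ (\sum_(c <- s) ((N.+1%:R^-1) ^+ n.+1)%:E)%E).
    by apply: lee_sum => c _; exact: leb_cell_le.
  by rewrite sumEFin big_const_seq count_predT iter_addr addr0 mulr_natl.
pose S := {ffun 'I_n.+1 -> 'I_(2 * N.+1)}.
pose g (t : S) : 'rV[int]_n.+1 := natrow N.+1 t.
(* For a fixed cell c the shifted cells already cover W. *)
have lower : (((size s)%:R * w)%:E <=
    \sum_(t : S) mu (W `&` translate (grid_point N (g t)) O))%E.
  apply: (@le_trans _ _ (\sum_(t : S) \sum_(c <- s) mu (W `&` cell N (g t + natrow 0 c)))%E).
    rewrite exchange_big/=; apply: (@le_trans _ _ (\sum_(c <- s) mu W)%E).
      by rewrite Ww sumEFin big_const_seq count_predT iter_addr addr0 mulr_natl.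
    apply: lee_sum => c _; apply: leb_bigcup_seq => x Wx.
    have [k xk] := cell_index_Q0 N (WQ _ Wx).
    (* The shift carrying the cell c to the cell k of x, offset by N + 1. *)
    have hi i : (k i + N.+1 - c i < 2 * N.+1)%N.
      by have := ltn_ord (k i); have := ltn_ord (c i); lia.
    exists [ffun i => Ordinal (hi i)]; first exact: mem_index_enum.
    split => //; rewrite (_ : _ + _ = natrow 0 k)//; apply/rowP => i.
    by rewrite !mxE ffunE /=; have := ltn_ord (c i); lia.
  apply: lee_sum => t _.
  apply: (le_trans (leb_sum_disjoint _ _ _ _)).
  - by apply: filter_uniq; exact: index_enum_uniq.
  - by move=> c; exact: measurable_cell.
  - move=> c c' x xc xc'; have /rowP e := addrI _ (cell_inj xc xc').
    by apply/ffunP => i; apply: val_inj; have := e i; rewrite !mxE /=; lia.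
  - apply: leb_le => x [Wx [c cs xc]]; split => //.
    move: cs; rewrite mem_filter => /andP[/asboolP cO _].
    move: xc; rewrite -translate_cell => -[y yc <-]; exists y => //; exact: cO.
have upper : (\sum_(t : S) mu (W `&` translate (grid_point N (g t)) O) <=
    (((2 * N.+1) ^ n.+1)%:R * ((2^-1) ^+ n.+2 * a * w))%:E)%E.
  apply: (@le_trans _ _ (\sum_(t : S) ((2^-1) ^+ n.+2 * a * w)%:E)%E).
    by apply: lee_sum => t _; exact/ltW/small.
  by rewrite sumEFin sumr_const card_ffun !card_ord mulr_natl.
have := le_trans lower upper; rewrite lee_fin mulrA ler_pM2r// leNgt => /negP; apply.
have -> : ((2 * N.+1) ^ n.+1)%:R * (2^-1 ^+ n.+2 * a) = N.+1%:R ^+ n.+1 * (a / 2) :> R.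
  rewrite natrX natrM exprMn (exprSr _ n.+1) exprVn.
  have : (2 : R) ^+ n.+1 != 0 by rewrite expf_neq0.
  move: (2 ^+ n.+1) (N.+1%:R ^+ n.+1) => u z u0.
  by field.
move: many; rewrite exprVn -ltr_pdivrMr ?invr_gt0 ?exprn_gt0 ?ltr0n//.
by rewrite invrK mulrC.
Qed.

(** Bernoulli's inequality, in the form giving (1 - t)^m <= 1/2 once m t >= 1. *)
Lemma bernoulli_decay (t : R) m : 0 <= t <= 1 -> (1 - t) ^+ m * (1 + m%:R * t) <= 1.
Proof.
move=> /andP[t0 t1]; elim: m => [|m IH]; first by rewrite expr0 mul0r addr0 mulr1.
apply: le_trans IH; rewrite exprSr -mulrA ler_wpM2l ?exprn_ge0 ?subr_ge0//.
have m0 : 0 <= m%:R :> R by [].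
by rewrite -natr1; nra.
Qed.

(** Greedy covering: each new translate removes a proportion at least t of what is left. *)
Lemma translates_cover O m (t : R) : open O -> 0 <= t <= 1 ->
  (t%:E <= ((2^-1) ^+ n.+2)%:E * mu (O `&` Q0))%E ->
  exists vs : seq 'rV[R]_n.+1, size vs = m /\
    (mu (Q0 `\` \bigcup_(v in [set` vs]) translate v O) <= ((1 - t) ^+ m)%:E * mu Q0)%E.
Proof.
move=> oO /andP[t0 t1] tO; elim: m => [|m [vs [<- IH]]].
  by exists [::]; split => //; rewrite expr0 mul1e; apply: leb_le => x [].
set W := (Q0 `\` _) in IH.
have WQ : W `<=` Q0 by move=> x [].
have [v hv] := exists_overlap oO WQ; exists (v :: vs); split => //.
have otr : open (translate v O).
  move/open_rVP: oO => oO; apply/open_rVP => x; rewrite translateE => /oO[e e0 xe].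
  exists e => // y xy; rewrite translateE; apply: xe => i; rewrite !mxE.
  by rewrite opprB addrA subrK; exact: xy.
have split : mu W = (mu (W `&` translate v O) + mu (W `&` ~` translate v O))%E.
  have mtr : measurable (translate v O : set T) by exact: measurable_open.
  exact: mtr.
have fW := leb_sub_Q0 WQ.
have fA : mu (W `&` translate v O) \is a fin_num by apply: leb_sub_Q0 => x [/WQ].
have fB : mu (W `&` ~` translate v O) \is a fin_num by apply: leb_sub_Q0 => x [/WQ].
apply: (@le_trans _ _ (mu (W `&` ~` translate v O))).
  apply: leb_le => x [Qx nx]; split; last first.
    by move=> xO; apply: nx; exists v => //=; rewrite inE eqxx.
  by split => // -[u us xu]; apply: nx; exists u => //=; rewrite inE us orbT.
apply: (@le_trans _ _ ((1 - t)%:E * mu W)%E); last first.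
  rewrite exprS EFinM -muleA lee_wpmul2l// lee_fin subr_ge0//.
have : (t%:E * mu W <= mu (W `&` translate v O))%E.
  by apply: le_trans hv; rewrite lee_wpmul2r// leb_ge0.
move: split; rewrite -(fineK fW) -(fineK fA) -(fineK fB) -EFinD -!EFinM !lee_fin => -[->].
by lra.
Qed.

Context {B : basis_family R n}.
Hypothesis hB : differentiation_basis B.
Hypothesis hinv : translation_invariant B.
Local Notation heavy := (heavy (B := B)).

(** Localize with the constant c below, then cover half of Q0 by m translates of the
heavy set O of F, with m t > 1 for t = theta a. The translates of F have total
measure at most (1/t + 1) a / c <= (1/theta + 1) / c = eta. *)
Lemma heavy_spread r alpha (eta : R) : 0 < r <= 1 -> 0 < eta ->
  tauberian (small_basis B r) alpha = +oo%E ->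
  exists G, [/\ measurable (G : set T), (mu G <= eta%:E)%E &
    (mu (Q0 `\` heavy r alpha G) <= (2^-1)%:E * mu Q0)%E].
Proof.
move=> /andP[r0 r1] e0 hoo; pose theta : R := (2^-1) ^+ n.+2.
have th0 : 0 < theta by rewrite exprn_gt0 ?invr_gt0.
have th1 : theta <= 1 by rewrite exprn_ile1 ?invr_ge0// invf_le1// ler1n.
pose c := (theta^-1 + 1) / eta.
have c0 : 0 < c by rewrite divr_gt0// addr_gt0 ?invr_gt0.
have [E [mE Eoo hE]] := heavy_tauberian hB (c * (3 ^ n.+1)%:R) hoo.
have [F [mF Foo hF]] := heavy_localize hB hinv r1 (ltW c0) mE Eoo hE.
set O := heavy r alpha F in hF.
have oO : open O by exact: open_heavy.
have fO : mu (O `&` Q0) \is a fin_num by apply: leb_sub_Q0 => x [].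
have fF : mu F \is a fin_num by rewrite ge0_fin_numE// leb_ge0.
set a := fine (mu (O `&` Q0)).
have Oa : mu (O `&` Q0) = a%:E by rewrite fineK.
have a1 : a <= 1.
  by rewrite -lee_fin -Oa; apply: le_trans leb_Q0_le1; apply: leb_le => x [].
have Fa : c * fine (mu F) < a.
  by move: hF; rewrite Oa -(fineK fF) -EFinM lte_fin.
have F0 : 0 <= fine (mu F) by rewrite fine_ge0// leb_ge0.
have a0 : 0 < a by apply: le_lt_trans Fa; rewrite mulr_ge0// ltW.
pose t := theta * a.
have t0 : 0 < t by rewrite mulr_gt0.
have t01 : 0 <= t <= 1 by rewrite ltW//= mulr_ile1// ltW.
pose m := (Num.truncn t^-1).+1.
have mt : 1 < m%:R * t by rewrite -ltr_pdivrMr// div1r; exact: truncnS_gt.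
have mle : m%:R <= t^-1 + 1 by rewrite -natr1 lerD2r truncn_le// invr_ge0 ltW.
have [|vs [szvs cover]] := translates_cover m oO t01.
  by rewrite Oa -EFinM.
exists (\bigcup_(v in [set` vs]) translate v F); split.
- by apply: fin_bigcup_measurable => // v _; exact: measurable_translate.
- apply: (@le_trans _ _ (\sum_(v <- vs) mu (translate v F))%E).
    by apply: leb_bigcup_seq => x [v vvs xv]; exists v.
  under eq_bigr do rewrite leb_translate -(fineK fF).
  rewrite sumEFin big_const_seq count_predT iter_addr addr0 szvs -mulr_natr lee_fin.
  have : fine (mu F) * m%:R <= a / c * (t^-1 + 1).
    by rewrite ler_pM// ltW// ltr_pdivlMr// mulrC.
  move=> /le_trans; apply.
  have -> : a / c * (t^-1 + 1) = (theta^-1 + a) / c.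
    rewrite mulrDr mulr1 mulrAC -mulrDl; congr (_ / c).
    by rewrite /t invfM mulrCA mulfV ?mulr1// gt_eqF.
  by rewrite ler_pdivrMr// /c mulrC divfK ?gt_eqF// lerD2l.
apply: (@le_trans _ _ (mu (Q0 `\` \bigcup_(v in [set` vs]) translate v O))).
  apply: leb_le => x [Qx nx]; split => // -[v vvs]; rewrite -heavy_translate// => hx.
  by apply: nx; apply: sub_heavy hx => y yv; exists v.
apply: (le_trans cover); rewrite lee_wpmul2r ?leb_ge0// lee_fin.
rewrite -[leRHS]mul1r ler_pdivlMr//; apply: le_trans (bernoulli_decay m t01).
have /andP[_ t1] := t01.
by rewrite ler_wpM2l ?exprn_ge0 ?subr_ge0// lerD2l ltW.
Qed.

End covering.

(** * Density implies Tauberian bounds *)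

Section density_tauberian.
Context {R : realType} {n : nat} {B : basis_family R n}.
Local Notation T := (leb_rV R n).
Local Notation mu := (lebesgue_measure_rV R n).
Local Notation Q0 := (cell (R := R) (n := n) 0 0).
Hypothesis hB : differentiation_basis B.
Hypothesis hinv : translation_invariant B.
Local Notation heavy := (heavy (B := B)).

(** Radii 1/(j+1) give sets shrinking to x along which the averages stay above
alpha, although the indicator of G vanishes at x. *)
Lemma density_heavy alpha (G : set T) : density_basis B -> 0 < alpha ->
  measurable G ->
  mu.-negligible [set x | ~ G x /\ forall j : nat, heavy j.+1%:R^-1 alpha G x].
Proof.
move=> hd a0 mG; have := hd G mG; apply: negligibleS => x [nGx hx] hcv.
have [S hS] := choice hx.
have BS j : B x (S j) by have [] := hS j.
have dS : diam (S j) @[j --> \oo] --> 0%E.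
  apply/fine_cvgP; have Sx j : S j x by have [_ h _] := hB x; have [] := h _ (BS j).
  have fS j : diam (S j) \is a fin_num.
    rewrite ge0_fin_numE; last exact: diam_ge0 (Sx j).
    by have [_ h _] := hS j; apply: lt_trans h _; exact: ltry.
  split; first exact: nearW.
  apply/cvgrPdist_lt => e e0; have [N _ hN] := near_infty_natSinv_lt (PosNum e0).
  exists N => // j /hN /= je; rewrite sub0r normrN ger0_norm.
    by apply: lt_trans je; rewrite -lte_fin fineK//; have [] := hS j.
  by rewrite fine_ge0//; exact: diam_ge0 (Sx j).
have := hcv S BS dS; rewrite indicE memNset//.
move=> /fine_cvgP[_ /cvgrPdist_lt/(_ _ a0)[N _ /(_ N)/=]].
have [_ _] := hS N; rewrite -(lt_average hB _ mG (BS N)) => h /(_ (leqnn _)).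
have [fN _ _] := average_bounds hB mG (BS N).
move: h; rewrite -(fineK fN) lte_fin sub0r normrN => h.
by move/(le_lt_trans (ler_norm _)); rewrite ltNge (ltW h).
Qed.

(** The set G k has measure at most q / 2^(k+3) with q = |Q0|, and all of Q0 up to
measure q/2 is heavy for it at radius 1/(k+1). The points of Q0 that are heavy
for only finitely many G k form the increasing union of the P j, of measure at
most q/2; with the union U of the G k and a null set this cannot exhaust Q0. *)
Lemma density_tauberian alpha : density_basis B -> 0 < alpha ->
  exists r : R, 0 < r /\ (tauberian (small_basis B r) alpha < +oo)%E.
Proof.
move=> hd a0; apply: contrapT => /forallNP h.
have hoo r : 0 < r -> tauberian (small_basis B r) alpha = +oo%E.
  move=> r0; apply/eqP; rewrite eq_le leey/= leNgt; apply/negP => lt.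
  by apply: (h r).
set q := mu Q0; have fq : q \is a fin_num by exact: leb_sub_Q0.
have q0 : 0 < fine q by rewrite fine_gt0// leb_Q0_gt0 -ge0_fin_numE ?leb_ge0.
have /choice[G hG] : forall k : nat, exists G : set T, [/\ measurable G,
    (mu G <= (fine q / 4 / (2 ^ k.+1)%:R)%:E)%E &
    (mu (Q0 `\` heavy k.+1%:R^-1 alpha G) <= (2^-1)%:E * q)%E].
  move=> k; apply: heavy_spread => //; last by apply: hoo; rewrite invr_gt0.
    by rewrite invr_gt0 ltr0n invf_le1 ?ltr0n// ler1n.
  by rewrite !divr_gt0// ltr0n expn_gt0.
pose U := \bigcup_k G k.
have mG k : measurable (G k) by have [] := hG k.
have mU : measurable (U : set T) by exact: bigcupT_measurable.
have U_le : (mu U <= (fine q / 4)%:E)%E.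
  apply: (le_trans (leb_bigcup _)).
  apply: (@le_trans _ _ (\sum_(0 <= k <oo) (0 + (fine q / 4 / (2 ^ k.+1)%:R)%:E))%E).
    apply: lee_nneseries => k _; first by move=> _; exact: leb_ge0.
    by rewrite add0e; have [] := hG k.
  apply: (le_trans (epsilon_trick _ _ _)) => //; first by rewrite ltW// divr_gt0.
  by rewrite eseries0// add0e.
pose P j := Q0 `\` \bigcup_(k in [set k | (j <= k)%N]) heavy k.+1%:R^-1 alpha (G k).
have mP j : measurable (P j : set T).
  apply: measurableD; first exact: measurable_cell.
  by apply: measurable_open; apply: bigcup_open => k _; exact: open_heavy.
have P_le : (mu (\bigcup_j P j) <= (2^-1)%:E * q)%E.
  have hcvg : (mu \o P) x @[x --> \oo] --> mu (\bigcup_j P j).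
    apply: nondecreasing_cvg_mu => //; first exact: bigcupT_measurable.
    move=> i j ij; apply/subsetPset => x [Qx nx]; split => // -[k /= jk hk].
    by apply: nx; exists k => //=; exact: leq_trans jk.
  rewrite -(cvg_lim _ hcvg)//; apply: lime_le.
    by apply/cvg_ex; exists (mu (\bigcup_j P j)).
  apply: nearW => j /=; have [_ _] := hG j; apply: le_trans; apply: leb_le.
  by move=> x [Qx nx]; split => // hx; apply: nx; exists j => /=.
have [N [mN N0 subN]] := density_heavy hd a0 mU.
(* Otherwise Q0 would have measure at most q / 2 + q / 4. *)
have : (q <= mu ((\bigcup_j P j) `|` U `|` N))%E.
  apply: leb_le => x Qx; apply: contrapT => /not_orP[/not_orP[nPx nUx] nNx].
  apply: nNx; apply: subN; split => // j.
  have [[k jk hk]|nk] := pselect ((\bigcup_(k in [set k | (j <= k)%N])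
      heavy k.+1%:R^-1 alpha (G k)) x); last by exfalso; apply: nPx; exists j.
  apply: (@heavy_le _ _ _ k.+1%:R^-1).
    by rewrite lef_pV2 ?posrE ?ltr0n// ler_nat ltnS.
  by apply: sub_heavy hk => y Gy; exists k.
apply/negP; rewrite -ltNge.
apply: (le_lt_trans (leb_setU _ _)); rewrite N0 adde0.
apply: (le_lt_trans (leb_setU _ _)); apply: (le_lt_trans (leeD P_le U_le)).
by rewrite -(fineK fq) -EFinM -EFinD lte_fin/=; lra.
Qed.

End density_tauberian.

Theorem theorem2 (R : realType) (n : nat) (B : basis_family R n)
    (hB : differentiation_basis B) (hinv : translation_invariant B) :
  density_basis B <->
  (forall alpha : R, (0 < alpha < 1)%R ->
     exists r : R, (0 < r)%R /\ (tauberian (small_basis B r) alpha < +oo)%E).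
Proof.
split=> [hd alpha /andP[a0 _]|]; first exact: density_tauberian.
exact: tauberian_density.
Qed.
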